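(* Suppose $p\in \mathbb{C}[z_1,\dots,z_n]$ is stable and vanishes to order $r$ at $0$. If we write out the homogeneous expansion of $p$, \[ p(z) = \sum_{j=r}^{d} P_j(z), \] with $P_j$ homogeneous of degree $j$, then for all $z\in\mathbb{C}^n$, \[ |p(z)| \leq \|z\|_{\infty}^{r}\, |P_r(\vec{1})| \exp(C_0+ C_1 \|z\|_{\infty} + C_2 \|z\|_{\infty}^2) \] where $C_0, C_1,C_2$ are constants depending only on $r$, $P_r(\vec{1})$, $P_{r+1}(\vec{1})$, $P_{r+2}(\vec{1})$, $\nabla P_{r}(\vec{1})$, $\nabla P_{r+1}(\vec{1})$. (That is, for each $n$, there are real-valued functions $C_0,C_1,C_2$ of these six data such that the inequality holds for every such $p$ and every $z$.)
   Context: A polynomial $p\in\mathbb{C}[z_1,\dots,z_n]$ is called stable if it has no zeros in $(\mathbb{C}_+)^n$, where $\mathbb{C}_+=\{z\in\mathbb{C}:\operatorname{Im} z>0\}$. Notation: $\vec{1}=(1,\dots,1)\in\mathbb{C}^n$, $\|z\|_\infty=\max_j|z_j|$, and $\nabla P=(\partial P/\partial z_1,\dots,\partial P/\partial z_n)$. ''Vanishes to order $r$ at $0$'' means that $P_r$ is the nonzero homogeneous term of lowest degree of $p$; $P_j=0$ for $j>\deg p$. *)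

(* Defs.v *)
From mathcomp Require Import all_boot all_order all_algebra.
From mathcomp Require Import complex mpoly.
From mathcomp Require Import reals.

Set Implicit Arguments.
Unset Strict Implicit.
Unset Printing Implicit Defensive.

Import Order.TTheory GRing.Theory Num.Theory.
Local Open Scope ring_scope.
Local Open Scope complex_scope.

Definition stable (R : realType) (n : nat) (p : {mpoly R[i][n]}) : Prop :=
  forall z : 'I_n -> R[i], (forall j, 0 < complex.Im (z j)) -> p.@[z] != 0.

(* The homogeneous component of total degree j. *)
Definition hcomp (R : realType) (n : nat) (p : {mpoly R[i][n]}) (j : nat) :
    {mpoly R[i][n]} :=
  pihomog mdeg j p.

Definition vanishes_to_order (R : realType) (n : nat) (p : {mpoly R[i][n]})
    (r : nat) : Prop :=
  hcomp p r != 0 /\ forall j, (j < r)%N -> hcomp p j = 0.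

Definition ones (R : realType) (n : nat) : 'I_n -> R[i] := fun=> 1.
Arguments ones {R n}.

Definition grad (R : realType) (n : nat) (p : {mpoly R[i][n]})
    (z : 'I_n -> R[i]) : 'I_n -> R[i] :=
  fun j => (p^`M(j)).@[z].

(* Normc.normc is the R-valued modulus, whereas `|z| lives in R[i]. *)
Definition supnorm (R : realType) (n : nat) (z : 'I_n -> R[i]) : R :=
  \big[Num.max/0]_(j < n) Normc.normc (z j).

(* Functions of r, P_r(1), P_(r+1)(1), P_(r+2)(1), grad P_r(1) and
   grad P_(r+1)(1), in this order. *)
Definition data_fun (R : realType) (n : nat) : Type :=
  nat -> R[i] -> R[i] -> R[i] -> ('I_n -> R[i]) -> ('I_n -> R[i]) -> R.

(* Main.v *)
Require Import Defs.
From mathcomp Require Import all_boot all_order all_algebra.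
From mathcomp Require Import complex mpoly.
From mathcomp Require Import reals.
From mathcomp Require Import ring lra zify.
From mathcomp Require sequences exp cyclic separable cyclotomic.

(** Let [rho > 0] bound the sup norm of [z], and write [1] for the vector of ones.

    A univariate polynomial without zeros in the upper half-plane and with nonzero
    constant term is [Q_0 prod (1 + a t)] with all [Im a <= 0].  The first two
    power sums of the [a] are determined by three coefficients of [Q], and the sign
    condition turns them into a bound on [sum |a|^2] ([sum_sqr_le]); as
    [|1 + w| <= exp (Re w + |w|^2 / 2)], this gives the Szasz inequality ([szasz]),
    which bounds [p] on the diagonal [t 1] by the required data.  The task is to
    compare [p z] with [p (s 1)], where [s = rho (-1 + 2i)].

    First, on a line in a direction with nonnegative real coordinates, the zeros
    lie below the domain of stability, and a reflection shows
    [|p z| <= |p (Re z + 2 i rho 1)|] ([stable_reflection]).  The new point is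
    [s 1 + 2 rho v] for some real [v] in the unit cube, and the factorisation on the
    line through [s 1] in the direction [v] shows that the shift by [2 rho v] costs at most
    [exp (3/2 |2 rho D_v p / p|)], with the logarithmic derivative taken at [s 1]
    ([stable_shift]).

    It remains to show that [rho |D_v p / p|] is at most quadratic in [rho] on the
    diagonal, uniformly in [v].  Let [g t] be this logarithmic derivative at [t 1].
    It has nonpositive imaginary part on the upper half-plane, and so does the
    function belonging to the direction [1 - v]; the sum of the two is the
    logarithmic derivative of [t |-> p (t 1)].  Hence [Im g] is controlled by the
    diagonal alone ([pair_Im]).  For the real part, [p (t 1) + t D_v p (t 1)] is
    again stable, so its Szasz inequality bounds [t g t] near the origin
    ([pair_small]); its third coefficient involves the gradient of [P_(r+2)], which
    is bounded because the same polynomial for the direction [1 - v] is stable as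
    well.  Far from the origin a Harnack inequality ([harnack]) bounds the
    variation of [g] between [i y / 2] and [i y] by [Im g], and a dyadic induction
    gives linear growth ([pair_chain]).

    All this needs [P_r 1 <> 0], which follows by comparing the lowest-order terms
    of [p] along the rays through [v] and [1] ([lead_ones_neq0]). *)

Set Implicit Arguments.
Unset Strict Implicit.
Unset Printing Implicit Defensive.

Import Order.TTheory GRing.Theory Num.Theory.
Local Open Scope ring_scope.
Local Open Scope complex_scope.
Local Notation normc := Normc.normc.
Local Notation expR := sequences.expR.
Local Notation Re := complex.Re.
Local Notation Im := complex.Im.

(** * Coordinates and modulus of a complex number *)

Section Modulus.
Variable R : realType.
Implicit Types z w : R[i].

Lemma normc_sqr z : normc z ^+ 2 = Re z ^+ 2 + Im z ^+ 2.
Proof. by case: z => a b; rewrite sqr_sqrtr // addr_ge0 ?sqr_ge0. Qed.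

Lemma normc_ge0 z : 0 <= normc z.
Proof. by case: z => a b; apply: sqrtr_ge0. Qed.

Lemma Re_mul z w : Re (z * w) = Re z * Re w - Im z * Im w.
Proof. by case: z w => a b [c d]. Qed.

Lemma Im_mul z w : Im (z * w) = Re z * Im w + Im z * Re w.
Proof. by case: z w => a b [c d]. Qed.

Lemma Re_add z w : Re (z + w) = Re z + Re w.
Proof. by case: z w => a b [c d]. Qed.

Lemma Im_add z w : Im (z + w) = Im z + Im w.
Proof. by case: z w => a b [c d]. Qed.

Lemma Re_opp z : Re (- z) = - Re z.
Proof. by case: z. Qed.

Lemma Im_opp z : Im (- z) = - Im z.
Proof. by case: z. Qed.

Lemma Re_inv z : Re z^-1 = Re z / normc z ^+ 2.
Proof. by rewrite normc_sqr; case: z. Qed.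

Lemma Im_inv z : Im z^-1 = - Im z / normc z ^+ 2.
Proof. by rewrite normc_sqr; case: z => a b; rewrite mulNr. Qed.

Lemma ler_normc z w : (normc z <= normc w) = (normc z ^+ 2 <= normc w ^+ 2).
Proof. by rewrite ler_sqr ?nnegrE ?normc_ge0. Qed.

Lemma normc_real (x : R) : normc x%:C = `|x|.
Proof. by rewrite /= expr0n addr0 sqrtr_sqr. Qed.

Lemma normcX z k : normc (z ^+ k) = normc z ^+ k.
Proof.
by elim: k => [|k IH]; rewrite ?expr0 ?Normc.normc1 // !exprS Normc.normcM IH.
Qed.

Lemma Re_le_normc z : `|Re z| <= normc z.
Proof.
rewrite -(@ler_sqr R) ?nnegrE ?normc_ge0 // normc_sqr -normrX ger0_norm ?sqr_ge0 //.
by rewrite lerDl sqr_ge0.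
Qed.

Lemma Im_le_normc z : `|Im z| <= normc z.
Proof.
rewrite -(@ler_sqr R) ?nnegrE ?normc_ge0 // normc_sqr -normrX ger0_norm ?sqr_ge0 //.
by rewrite lerDr sqr_ge0.
Qed.

Lemma normc_gt0 z : z != 0 -> 0 < normc z.
Proof.
move=> z0; rewrite lt_def normc_ge0 andbT.
by apply: contra z0 => /eqP/Normc.eq0_normc ->.
Qed.

Lemma real_complex_eq0 (x : R) : (x%:C == 0) = (x == 0).
Proof. exact: (inj_eq (@complexI R) x 0). Qed.

Lemma normc_prod (I : Type) (s : seq I) (F : I -> R[i]) :
  normc (\prod_(i <- s) F i) = \prod_(i <- s) normc (F i).
Proof.
by elim/big_rec2: _ => [|i x y _ <-]; rewrite ?Normc.normc1 ?Normc.normcM.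
Qed.

Lemma le_normc_sum (I : Type) (s : seq I) (F : I -> R[i]) :
  normc (\sum_(i <- s) F i) <= \sum_(i <- s) normc (F i).
Proof.
elim/big_rec2: _ => [|i x y _ h]; first by rewrite Normc.normc0.
exact: le_trans (le_normcD _ _) (lerD _ _).
Qed.

Lemma Re_sum (I : Type) (s : seq I) (F : I -> R[i]) :
  Re (\sum_(i <- s) F i) = \sum_(i <- s) Re (F i).
Proof. by elim/big_rec2: _ => [|i x y _ <-] //; rewrite Re_add. Qed.

Lemma Im_sum (I : Type) (s : seq I) (F : I -> R[i]) :
  Im (\sum_(i <- s) F i) = \sum_(i <- s) Im (F i).
Proof. by elim/big_rec2: _ => [|i x y _ <-] //; rewrite Im_add. Qed.

End Modulus.

(** * Products of linear factors normalised at the origin *)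

Section Factors.
Variable R : realType.
Local Notation C := R[i].
Implicit Types (s : seq C) (Q : {poly C}).

(** Since [Q] does not vanish at the origin, its roots may be replaced by the
    opposites [a] of their inverses, so that the power sums of the [a] are read
    off the first coefficients of [Q]. *)
Lemma factor_at0 Q : Q.[0] != 0 ->
  exists2 s, Q = Q.[0] *: \prod_(a <- s) (1 + a *: 'X)
    & forall a, a \in s -> a != 0 /\ root Q (- a^-1).
Proof.
move=> Q0.
have [r Er] := closed_field_poly_normal Q.
have Qn0 : Q != 0 by apply: contraNneq Q0 => ->; rewrite horner0.
have rootQ b : b \in r -> b != 0 /\ root Q b.
  move=> br; have rb : root Q b.
    by rewrite Er rootZ ?lead_coef_eq0 // root_prod_XsubC.
  by split=> //; apply: contraNneq Q0 => b0; move: rb; rewrite b0.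

exists [seq - b^-1 | b <- r]; last first.
  move=> a /mapP[b /rootQ[b0 rb] ->]; rewrite oppr_eq0 invr_eq0 b0; split=> //.
  by rewrite invrN opprK invrK.
have E t : all (fun b => b != 0) t -> \prod_(b <- t) ('X - b%:P) =
   (\prod_(b <- t) (- b)) *: \prod_(a <- [seq - b^-1 | b <- t]) (1 + a *: 'X) :> {poly C}.
  elim: t => [|b t IH] /=; first by rewrite !big_nil scale1r.
  case/andP=> b0 bt; rewrite !big_cons IH // -scalerAr [X in _ = X *: _]mulrC.
  rewrite -[RHS]scalerA; congr (_ *: _); rewrite scalerAl; congr (_ * _).
  rewrite scalerDr scalerA mulrNN divff // scale1r addrC; congr (_ + _).
  by rewrite scaleNr alg_polyC.
have rn0 : all (fun b => b != 0) r by apply/allP => b /rootQ[].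
set T := \prod_(a <- _) _.
have EQ : Q = (lead_coef Q * \prod_(b <- r) - b) *: T.
  by rewrite {1}Er E // scalerA.
suff E0 : Q.[0] = lead_coef Q * \prod_(b <- r) - b by rewrite E0.
have T0 : T.[0] = 1.
  by rewrite horner_prod big1_seq // => a _; rewrite !hornerE.
by rewrite {1}EQ hornerZ T0 mulr1.
Qed.

Lemma coef_linear_mul (a : C) Q k :
  ((1 + a *: 'X) * Q)`_k = Q`_k + a * (if k is j.+1 then Q`_j else 0).
Proof.
rewrite mulrDl mul1r coefD -scalerAl coefZ coefXM.
by case: k.
Qed.

Lemma factors_coef0 s : (\prod_(a <- s) (1 + a *: 'X))`_0 = 1 :> C.
Proof.
elim: s => [|a s IH]; first by rewrite big_nil coef1.
by rewrite big_cons coef_linear_mul IH mulr0 addr0.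
Qed.

Lemma factors_coef1 s : (\prod_(a <- s) (1 + a *: 'X))`_1 = \sum_(a <- s) a :> C.
Proof.
elim: s => [|a s IH]; first by rewrite !big_nil coef1.
by rewrite !big_cons coef_linear_mul IH factors_coef0 mulr1 addrC.
Qed.

Lemma factors_coef2 s :
  (\prod_(a <- s) (1 + a *: 'X))`_2 *+ 2 =
  (\sum_(a <- s) a) ^+ 2 - \sum_(a <- s) a ^+ 2 :> C.
Proof.
elim: s => [|a s IH]; first by rewrite !big_nil coef1 expr0n subr0 mul0rn.
rewrite !big_cons coef_linear_mul mulrnDl IH factors_coef1.
by ring.
Qed.

Lemma horner_factors s z :
  (\prod_(a <- s) (1 + a *: 'X)).[z] = \prod_(a <- s) (1 + a * z) :> C.
Proof. by rewrite horner_prod; apply: eq_bigr => a _; rewrite !hornerE. Qed.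

(** Each factor satisfies
    [|1 + w|^2 = 1 + 2 Re w + |w|^2 <= exp (2 Re w + |w|^2)].  Unlike a bound by
    [exp |w|], this keeps the linear terms together, and their sum is known from
    one coefficient although the sum of the [|a|] is not. *)
Lemma normc_prod1D_le s z :
  normc (\prod_(a <- s) (1 + a * z)) <=
  expR (Re (z * \sum_(a <- s) a) + normc z ^+ 2 * (\sum_(a <- s) normc a ^+ 2) / 2).
Proof.
rewrite normc_prod !mulr_sumr Re_sum mulr_suml -big_split /=.
rewrite exp.expR_sum; apply: ler_prod => a _; rewrite normc_ge0 /=.
rewrite -(@ler_sqr R) ?nnegrE ?normc_ge0 ?exp.expR_ge0 // -exp.expRM_natl.
apply: le_trans (exp.expR_ge1Dx _); rewrite !normc_sqr Re_add Im_add Re_mul Im_mul /= Re_mul.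
by lra.
Qed.

(** The identity [|a|^2 = Re (a^2) + 2 (Im a)^2] reduces the claim to
    [sum (Im a)^2 <= (sum Im a)^2], which holds because the [Im a] have the same
    sign.  This is where stability makes the second power sum of the moduli
    computable from two coefficients. *)
Lemma sum_sqr_le s : (forall a, a \in s -> Im a <= 0) ->
  \sum_(a <- s) normc a ^+ 2 <=
  normc (\sum_(a <- s) a) ^+ 2 - Re ((\sum_(a <- s) a) ^+ 2 - \sum_(a <- s) a ^+ 2).
Proof.
move=> sle; rewrite normc_sqr Re_add Re_opp expr2 Re_mul -!expr2.
have -> : \sum_(a <- s) normc a ^+ 2 =
    Re (\sum_(a <- s) a ^+ 2) + 2 * \sum_(a <- s) (Im a) ^+ 2.
  rewrite Re_sum mulr_sumr -big_split; apply: eq_bigr => a _ /=.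
  by rewrite normc_sqr expr2 Re_mul; ring.
suff [h _] : \sum_(a <- s) Im a ^+ 2 <= (Im (\sum_(a <- s) a)) ^+ 2
    /\ Im (\sum_(a <- s) a) <= 0 by lra.
elim: s sle => [|a s IH] sle; first by rewrite !big_nil /= expr0n.
have [b|h1 h2] := IH; first by move=> bs; apply: sle; rewrite inE bs orbT.
have ha := sle _ (mem_head a s).
rewrite !big_cons Im_add; split; last by lra.
have : 0 <= Im a * Im (\sum_(j <- s) j) by rewrite mulr_le0.
by move=> h3; rewrite sqrrD; lra.
Qed.

(** On the positive imaginary axis every factor has real part at least 1. *)
Lemma normc_prod1D_ge1 s (y : R) : 0 <= y -> (forall a, a \in s -> Im a <= 0) ->
  1 <= normc (\prod_(a <- s) (1 + a * (0 +i* y))).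
Proof.
move=> y0 sle; rewrite normc_prod.
elim: s sle => [|a s IH] sle; first by rewrite big_nil.
rewrite big_cons; apply: mulr_ege1; last first.
  by apply: IH => b bs; apply: sle; rewrite inE bs orbT.
have ha := sle _ (mem_head a s).
rewrite -(@ler_sqr R) ?nnegrE ?normc_ge0 // normc_sqr Re_add Im_add Re_mul Im_mul /=.
have : 0 <= - Im a * y by rewrite mulr_ge0 ?oppr_ge0.
have := sqr_ge0 (Im a * y); have := sqr_ge0 (Re a * y).
by nra.
Qed.

(** The points [0] and ['i] are symmetric about the line of height 1/2, and every
    root lies on the side of [0]. *)
Lemma reflection Q : (forall z, root Q z -> Im z <= 2^-1) ->
  normc Q.[0] <= normc Q.['i].
Proof.
move=> rQ; have [->|Q0] := eqVneq Q 0; first by rewrite !horner0.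
have [r Er] := closed_field_poly_normal Q.
have {}rQ z : z \in r -> Im z <= 2^-1.
  by move=> zr; apply: rQ; rewrite Er rootZ ?lead_coef_eq0 // root_prod_XsubC.
rewrite Er !hornerZ !Normc.normcM ler_wpM2l ?normc_ge0 // !horner_prod !normc_prod.
rewrite big_seq [leRHS]big_seq; apply: ler_prod => z zr; rewrite normc_ge0 /=.
rewrite ler_normc !normc_sqr !hornerE !(Re_add, Im_add, Re_opp, Im_opp) /=.
by have := rQ _ zr; nra.
Qed.

Lemma deriv_factors s z : (forall a, a \in s -> 1 + a * z != 0) ->
  (\prod_(a <- s) (1 + a *: 'X))^`().[z] =
  \prod_(a <- s) (1 + a * z) * \sum_(a <- s) a / (1 + a * z) :> C.
Proof.
elim: s => [|a s IH] sn0; first by rewrite !big_nil derivC horner0 mulr0.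
have a0 := sn0 _ (mem_head a s).
rewrite !big_cons derivM derivD derivZ derivX derivC add0r alg_polyC.
rewrite hornerD !hornerM IH; last by move=> b bs; apply: sn0; rewrite inE bs orbT.
by rewrite !hornerE horner_factors /=; field.
Qed.

End Factors.

(** * A Harnack inequality for quotients of polynomials *)

Section Harnack.
Variable R : realType.
Local Notation C := R[i].

Lemma prim_root_exists N : (0 < N)%N -> exists w : C, N.-primitive_root w.
Proof.
move=> N0; have [r Er] := closed_field_poly_normal ('X^N - 1 : {poly C}).
have mon := monicXnsubC (1 : C) N0.
rewrite (monicP mon) scale1r in Er.
have /(cyclic.has_prim_root N0) : all N.-unity_root r.
  by apply/allP => z zr; rewrite /root_of_unity Er root_prod_XsubC.
have -> : uniq r.
  rewrite -separable.separable_prod_XsubC -Er.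
  by apply: cyclotomic.separable_Xn_sub_1; rewrite pnatr_eq0 -lt0n.
have -> : (N <= size r)%N.
  by rewrite -ltnS -(size_XnsubC (1 : C) N0) Er size_prod_XsubC.
by move=> /(_ isT isT) /hasP[w _ pw]; exists w.
Qed.

Lemma sum_expr_prim_root N (w : C) m : N.-primitive_root w ->
  \sum_(j < N) (w ^+ j) ^+ m = if (N %| m)%N then N%:R else 0.
Proof.
move=> pw; have wm j : (w ^+ j) ^+ m = (w ^+ m) ^+ j by rewrite -!exprM mulnC.
rewrite (eq_bigr _ (fun j _ => wm (nat_of_ord j))) (prim_order_dvd pw).
case: eqP => [->|/eqP wm1].
  by rewrite (eq_bigr (fun=> 1)) => [|j _]; rewrite ?expr1n // sumr_const card_ord.
apply: (@mulfI _ (w ^+ m - 1)); first by rewrite subr_eq0.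
by rewrite -subrX1 mulr0 -exprM mulnC exprM (prim_expr_order pw) expr1n subrr.
Qed.

Lemma normc_unity N (w : C) : (0 < N)%N -> w ^+ N = 1 -> normc w = 1.
Proof.
move=> N0 wN; apply/eqP; rewrite -(pexpr_eq1 N0) ?normc_ge0 //.
by rewrite -normcX wN Normc.normc1.
Qed.

(** Averaging over roots of unity extracts the coefficients whose index is
    congruent to [- m]; for [N] larger than the degree this plays the role of
    Cauchy's integral formula. *)
Lemma sum_horner_prim_root N (w : C) (T : {poly C}) m :
  N.-primitive_root w -> (size T <= N)%N ->
  \sum_(j < N) T.[w ^+ j] * (w ^+ j) ^+ m =
  N%:R * \sum_(l < N | (N %| l + m)%N) T`_l.
Proof.
move=> pw sT; under eq_bigr => j _ do
  rewrite (horner_coef_wide _ sT) mulr_suml.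
rewrite exchange_big mulr_sumr [RHS]big_mkcond; apply: eq_bigr => l _ /=.
under eq_bigr => j _ do rewrite -mulrA -exprD.
by rewrite -mulr_sumr (sum_expr_prim_root _ pw); case: ifP => _; rewrite ?mulr0 // mulrC.
Qed.

(** With [2 Re T = T + conj T], the averages of [conj T] against positive
    frequencies vanish, so [T`_k] is an average of [2 Re T >= 0] times a
    unimodular weight, hence at most the average of [2 Re T] itself. *)
Lemma caratheodory_coef (T : {poly C}) k : (0 < k)%N ->
  (forall z, normc z = 1 -> 0 <= Re T.[z]) -> normc T`_k <= 2 * Re T`_0.
Proof.
move=> k0 Tpos.
(* [N] exceeds twice the degree, so that distinct frequencies do not alias. *)
pose N := (2 * size T + k).+1.
have [w pw] := @prim_root_exists N isT.
have sT : (size T <= N)%N by rewrite /N; lia.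
have wN : w ^+ N = 1 := prim_expr_order pw.
have w1 j : normc (w ^+ j) = 1.
  by apply: (@normc_unity N) => //; rewrite -exprM mulnC exprM wN expr1n.
have kN : (k < N)%N by rewrite /N; lia.
have aux l M q : (l < M)%N -> (k < M)%N -> (l + (M - k) = q * M)%N -> l = k.
  by case: q => [|[|q]]; rewrite ?mulSn; lia.
have E0 : \sum_(j < N) T.[w ^+ j] = N%:R * T`_0.
  transitivity (\sum_(j < N) T.[w ^+ j] * (w ^+ j) ^+ 0).
    by apply: eq_bigr => j _; rewrite expr0 mulr1.
  rewrite (sum_horner_prim_root 0 pw sT) (big_pred1 (@Ordinal N 0 isT)) // => l.
  rewrite addn0 /= -val_eqE /=; case: l => [[|l] /= lN]; first by rewrite dvdn0.
  by rewrite gtnNdvd.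
have Ek : \sum_(j < N) T.[w ^+ j] * (w ^+ j) ^+ (N - k) = N%:R * T`_k.
  rewrite (sum_horner_prim_root (N - k) pw sT) (big_pred1 (Ordinal kN)) // => l.
  rewrite /= -val_eqE /=; apply/idP/eqP => [|->]; last by rewrite subnKC ?dvdnn // ltnW.
  by case/dvdnP=> q; apply: aux.
have Ec : \sum_(j < N) T.[w ^+ j] * (w ^+ j) ^+ k = 0.
  rewrite (sum_horner_prim_root k pw sT) big1 ?mulr0 // => l /dvdnP[q Eq].
  have lT : (size T <= l)%N by case: q Eq => [|q]; rewrite ?mulSn /N; lia.
  by rewrite nth_default.
have Ec' : \sum_(j < N) (T.[w ^+ j])^* * (w ^+ j) ^+ (N - k) = 0.
  rewrite -[RHS](conjc0 R) -[in RHS]Ec rmorph_sum; apply: eq_bigr => j _ /=.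
  rewrite rmorphM /=; congr (_ * _); set u := w ^+ j.
  have u0 : u != 0 by apply/eqP => u0; have := w1 j; rewrite -/u u0 Normc.normc0; lra.
  have uk0 : u ^+ k != 0 by rewrite expf_neq0.
  apply: (mulfI uk0); rewrite -exprD subnKC ?(ltnW kN) //.
  rewrite {1}/u -exprM mulnC exprM wN expr1n -sqr_normc.
  by rewrite (_ : `|u ^+ k| = (normc (u ^+ k))%:C) // normcX w1 expr1n expr1n.
have : normc (N%:R * T`_k) <= 2 * Re (N%:R * T`_0).
  have -> : N%:R * T`_k = \sum_(j < N) (2 * Re T.[w ^+ j])%:C * (w ^+ j) ^+ (N - k).
    rewrite -Ek -[LHS]addr0 -[X in _ + X = _]Ec' -big_split /=; apply: eq_bigr => j _ /=.
    by rewrite -mulrDl addcJ rmorphM rmorph_nat.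
  apply: le_trans (le_normc_sum _ _) _.
  rewrite -E0 Re_sum mulr_sumr; apply: ler_sum => j _.
  rewrite Normc.normcM normcX w1 expr1n mulr1 normc_real ger0_norm //.
  by rewrite mulr_ge0 // Tpos.
have N0 : 0 < N%:R :> R by rewrite ltr0n.
have EN : N%:R = (N%:R : R)%:C :> C by rewrite rmorph_nat.
rewrite Normc.normcM EN normc_real (ger0_norm (ltW N0)) Re_mul /= mul0r subr0.
by rewrite mulrCA ler_pM2l.
Qed.

(** The bound on the coefficients is summed as a geometric series: at radius
    2/3 the series of the [(2/3)^i], [i > 0], is 2. *)
Lemma harnack_poly (T : {poly C}) (z : C) :
  (forall u, normc u = 1 -> 0 <= Re T.[u]) -> normc z <= 2 / 3 ->
  normc (T.[z] - T.[0]) <= 4 * Re T.[0].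
Proof.
move=> Tpos z23; have T0 : 0 <= Re T`_0.
  by have := caratheodory_coef (ltn0Sn 0) Tpos; have := normc_ge0 T`_1; lra.
rewrite horner_coef0 (@horner_coef_wide _ (size T).+1) // big_ord_recl.
rewrite expr0 mulr1 addrAC subrr add0r; apply: le_trans (le_normc_sum _ _) _.
apply: (@le_trans _ _ (\sum_(i < size T) (2 * Re T`_0) * (2 / 3) ^+ i.+1)).
  apply: ler_sum => i _; rewrite Normc.normcM normcX.
  apply: ler_pM; rewrite ?normc_ge0 ?exprn_ge0 ?normc_ge0 //.
    exact: caratheodory_coef.
  by apply: lerXn2r; rewrite ?nnegrE ?normc_ge0 //; lra.
rewrite -mulr_sumr.
suff h d : \sum_(i < d) (2 / 3) ^+ i.+1 = 2 - 2 * (2 / 3) ^+ d :> R.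
  rewrite h; have : 0 <= (2 / 3) ^+ size T :> R by rewrite exprn_ge0 //; lra.
  by nra.
elim: d => [|d IH]; first by rewrite big_ord0 expr0; lra.
by rewrite big_ord_recr /= IH exprS; lra.
Qed.

Lemma exists_small_expr (e : R) : 0 < e -> exists k, (3 / 4) ^+ k < e.
Proof.
move=> e0; exists (Num.bound (3 * e^-1)).
have := @archi_boundP R (3 * e^-1) _; set k := Num.bound _ => hk.
have {}hk : 3 * e^-1 < k%:R by apply: hk; rewrite mulr_ge0 // invr_ge0 ltW.
have bern j : 1 + j%:R / 3 <= (4 / 3) ^+ j :> R.
  elim: j => [|j IH]; first by rewrite expr0; lra.
  rewrite exprS -natr1.
  have : 0 <= j%:R :> R by [].
  by nra.
have -> : (3 / 4) ^+ k = ((4 / 3) ^+ k)^-1 :> R.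
  by rewrite -exprVn; congr (_ ^+ _); field.
rewrite -[e]invrK ltf_pV2 ?posrE ?invr_gt0 ?exprn_gt0 //; last by lra.
by have := bern k; lra.
Qed.

Lemma poly_bounded_disc (T : {poly C}) (r : R) :
  exists2 M, 0 <= M & forall z, normc z <= r -> normc T.[z] <= M.
Proof.
exists (\sum_(i < size T) normc T`_i * `|r| ^+ i).
  by apply: sumr_ge0 => i _; rewrite mulr_ge0 ?normc_ge0 ?exprn_ge0.
move=> z zr; rewrite horner_coef; apply: le_trans (le_normc_sum _ _) _.
apply: ler_sum => i _; rewrite Normc.normcM normcX ler_wpM2l ?normc_ge0 //.
apply: lerXn2r; rewrite ?nnegrE ?normc_ge0 //.
exact: le_trans zr (ler_norm _).
Qed.

Lemma normc_1D_ge (a z : C) : normc a <= 3 / 4 -> normc z <= 1 ->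
  1 / 4 <= normc (1 + a * z).
Proof.
move=> a34 z1.
have := le_normcD (1 + a * z) (- (a * z)).
rewrite addrK normcN Normc.normcM Normc.normc1.
by have := normc_ge0 a; have := normc_ge0 z; nra.
Qed.

Lemma approx_factor_disc (a : C) (e : R) : normc a <= 3 / 4 -> 0 < e ->
  exists T : {poly C}, forall z, normc z <= 1 -> normc ((1 + a * z)^-1 - T.[z]) <= e.
Proof.
move=> a34 e0; have [|k hk] := @exists_small_expr (e / 4); first by lra.
exists (\sum_(i < k) (- a *: 'X) ^+ i) => z z1.
have n4 := normc_1D_ge a34 z1.
have d0 : 1 + a * z != 0 by apply/eqP => d0; move: n4; rewrite d0 Normc.normc0; lra.
have -> : (1 + a * z)^-1 - (\sum_(i < k) (- a *: 'X) ^+ i).[z] =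
   (- a * z) ^+ k / (1 + a * z).
  rewrite horner_sum; under eq_bigr => i _ do rewrite horner_exp hornerZ hornerX.
  have := subrX1 (- a * z) k; set S := \sum_(i < k) _ => hS.
  apply: (mulIf d0); rewrite mulrBl mulVf // divfK //.
  have -> : (- a * z) ^+ k = 1 + (- a * z - 1) * S by rewrite -hS; ring.
  by ring.
rewrite Normc.normcM normcX Normc.normcV ler_pdivrMr ?normc_gt0 //.
have : normc (- a * z) ^+ k <= (3 / 4) ^+ k.
  apply: lerXn2r; rewrite ?nnegrE ?normc_ge0 //; first by lra.
  rewrite Normc.normcM normcN.
  by have := normc_ge0 a; have := normc_ge0 z; nra.
by nra.
Qed.

(** A quotient of polynomials whose poles stay at distance at least 4/3 from the
    centre is a uniform limit of polynomials on the closed unit disc (truncate a geometric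
    series for each pole).  Inequalities for polynomials thus pass to quotients
    without any complex integration. *)
Lemma approx_ratio_disc (s : seq C) (Q : {poly C}) (e : R) :
  (forall a, a \in s -> normc a <= 3 / 4) -> 0 < e ->
  exists T : {poly C}, forall z, normc z <= 1 ->
    normc (Q.[z] / (\prod_(a <- s) (1 + a * z)) - T.[z]) <= e.
Proof.
elim: s e => [|a s IH] e sle e0.
  by exists Q => z _; rewrite big_nil divr1 subrr Normc.normc0 ltW.
have [||T hT] := IH (e / 8); [|lra|].
  by move=> b bs; apply: sle; rewrite inE bs orbT.
have [M M0 hM] := poly_bounded_disc T 1.
have a34 := sle _ (mem_head a s).
have [|T1 hT1] := @approx_factor_disc a (e / 2 / (M + 1)) a34.
  by rewrite !divr_gt0 //; lra.
exists (T * T1) => z z1; rewrite big_cons invfM hornerM.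
set p := \prod_(j <- s) _.
have -> : Q.[z] * ((1 + a * z)^-1 * p^-1) - T.[z] * T1.[z] =
   (Q.[z] / p - T.[z]) * (1 + a * z)^-1 + T.[z] * ((1 + a * z)^-1 - T1.[z]) by ring.
apply: le_trans (le_normcD _ _) _; rewrite !Normc.normcM.
have n4 := normc_1D_ge a34 z1.
have h1 : normc (1 + a * z)^-1 <= 4.
  by rewrite Normc.normcV invf_ple ?posrE; lra.
have h2 : normc T.[z] * normc ((1 + a * z)^-1 - T1.[z]) <= e / 2.
  apply: (@le_trans _ _ ((M + 1) * (e / 2 / (M + 1)))).
    apply: ler_pM; rewrite ?normc_ge0 ?hT1 //.
    by have := hM _ z1; lra.
  by rewrite mulrC divfK //; lra.
have : normc (Q.[z] / p - T.[z]) * normc (1 + a * z)^-1 <= e / 8 * 4.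
  by apply: ler_pM; rewrite ?normc_ge0 ?hT.
by lra.
Qed.

(** Apply the polynomial case to approximations of [i G/P] on the disc of centre
    [i y] and radius [3y/4]: the roots of [P] are at distance at least [y] from
    the centre, and the half radius [y/2] is 2/3 of [3y/4]. *)
Lemma harnack (P G : {poly C}) (y : R) (s : C) :
  (forall z, 0 < Im z -> P.[z] != 0) ->
  (forall z, 0 < Im z -> Im (G.[z] / P.[z]) <= 0) ->
  0 < y -> normc (s - y *i) <= y / 2 ->
  normc (G.[s] / P.[s] - G.[y *i] / P.[y *i]) <= - 4 * Im (G.[y *i] / P.[y *i]).
Proof.
move=> Pn0 ImG y0 sy; pose eta : R := 3 / 4 * y.
have eta0 : 0 < eta by rewrite /eta; lra.
pose c : C := y *i; pose L : {poly C} := c%:P + eta%:C *: 'X.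
have LE z : L.[z] = c + eta%:C * z by rewrite /L !hornerE.
have ImL z : normc z <= 1 -> 0 < Im L.[z].
  move=> z1; rewrite LE Im_add Im_mul /= mul0r addr0.
  have := Im_le_normc z; rewrite ler_norml => /andP[h _].
  by rewrite /eta; nra.
pose Pt := P \Po L; pose Gt := G \Po L.
have PtE z : Pt.[z] = P.[L.[z]] by rewrite horner_comp.
have GtE z : Gt.[z] = G.[L.[z]] by rewrite horner_comp.
have L0 : L.[0] = c by rewrite LE mulr0 addr0.
have Pt0 : Pt.[0] != 0 by rewrite PtE; apply/Pn0/ImL; rewrite Normc.normc0.
have [r Er hr] := factor_at0 Pt0.
have r34 a : a \in r -> normc a <= 3 / 4.
  case/hr=> a0 /rootP; rewrite PtE => Pa.
  have : Im L.[- a^-1] <= 0.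
    by rewrite leNgt; apply/negP => /Pn0; rewrite Pa eqxx.
  rewrite LE Im_add Im_mul /= mul0r addr0 Im_opp => h.
  have := Im_le_normc a^-1; rewrite ler_norml Normc.normcV => /andP[_ h2].
  have na := normc_gt0 a0.
  have : y <= eta * (normc a)^-1 by nra.
  by rewrite ler_pdivlMr // /eta; nra.
pose h z := 'i * (G.[L.[z]] / P.[L.[z]]).
have hE z : h z = ('i / Pt.[0] *: Gt).[z] / \prod_(a <- r) (1 + a * z).
  rewrite hornerZ GtE /h -PtE [in RHS]mulrAC -mulrA -!mulrA; congr (_ * _).
  rewrite Er !hornerE horner_factors.
  have -> : (\prod_(a <- r) (1 + a *: 'X)).[0] = 1 :> C.
    by rewrite horner_coef0 factors_coef0.
  by rewrite mulr1 invfM mulrC.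
have Reh z : Re (h z) = - Im (G.[L.[z]] / P.[L.[z]]).
  by rewrite /h Re_mul /= mul0r add0r mul1r.
pose z0 := (s - c) / eta%:C.
have etaC : eta%:C != 0 :> C by rewrite real_complex_eq0 gt_eqF.
have z023 : normc z0 <= 2 / 3.
  rewrite /z0 Normc.normcM Normc.normcV normc_real gtr0_norm // ler_pdivrMr //.
  by rewrite /eta /c; lra.
have Lz0 : L.[z0] = s by rewrite LE /z0 mulrCA divff // mulr1 addrC subrK.
suff H : normc (h z0 - h 0) <= 4 * Re (h 0).
  move: H; rewrite Reh /h -mulrBr Normc.normcM L0 Lz0 -/c.
  rewrite (_ : normc 'i = 1) ?mul1r; first by lra.
  by rewrite /= expr0n expr1n add0r sqrtr1.
(* Adding [e/10] makes the real part of the approximation nonnegative. *)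
apply/ler_addgt0Pr => e e0.
have [|T hT] := @approx_ratio_disc r ('i / Pt.[0] *: Gt) (e / 10) r34; first by lra.
have {}hT z : normc z <= 1 -> normc (h z - T.[z]) <= e / 10.
  by move=> z1; rewrite hE hT.
have ReT z : normc z <= 1 -> `|Re (h z) - Re T.[z]| <= e / 10.
  by move=> /hT; apply: le_trans; rewrite -Re_opp -Re_add Re_le_normc.
have H : normc ((T + (e / 10)%:C%:P).[z0] - (T + (e / 10)%:C%:P).[0]) <=
     4 * Re (T + (e / 10)%:C%:P).[0].
  apply: harnack_poly => // u u1; rewrite hornerD hornerC Re_add /=.
  have u1' : normc u <= 1 by rewrite u1.
  have := ReT u u1'; rewrite ler_norml Reh.
  by have := ImG _ (ImL _ u1'); lra.
have n0 : normc 0 <= 1 :> R by rewrite Normc.normc0.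
have n1 : normc z0 <= 1 by lra.
move: H; rewrite !hornerD !hornerC Re_add /= opprD addrACA subrr addr0 => H.
have -> : h z0 - h 0 = (h z0 - T.[z0]) + (T.[z0] - T.[0]) - (h 0 - T.[0]) by ring.
have := le_normcD (h z0 - T.[z0] + (T.[z0] - T.[0])) (- (h 0 - T.[0])).
have := le_normcD (h z0 - T.[z0]) (T.[z0] - T.[0]); rewrite normcN.
have := hT _ n0; have := hT _ n1; have := ReT _ n0; rewrite ler_norml => /andP[].
by lra.
Qed.

End Harnack.

(** * Univariate stable polynomials *)

Section Univariate.
Variable R : realType.
Local Notation C := R[i].

Definition ustable (Q : {poly C}) := forall z, 0 < Im z -> Q.[z] != 0.

(** Passage to the limit [y -> 0] for inequalities that are polynomial in a real
    parameter. *)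
Lemma Im_horner0_le0 (Q : {poly C}) :
  (forall y : R, 0 < y <= 1 -> Im Q.[y%:C] <= 0) -> Im Q.[0] <= 0.
Proof.
move=> h; have [T ET] : exists T, Q = Q.[0]%:P + 'X * T.
  have /factor_theorem[T ET] : root (Q - Q.[0]%:P) 0.
    by rewrite rootE hornerD hornerN hornerC subrr.
  by exists T; rewrite mulrC -['X]subr0 -ET addrC subrK.
have [M M0 hM] := poly_bounded_disc T 1.
rewrite leNgt; apply/negP => Q0.
pose y := Num.min 1 (Im Q.[0] / (M + 1) / 2).
have y0 : 0 < y by rewrite /y lt_min ltr01 /= !divr_gt0 //; lra.
have y1 : y <= 1 by rewrite /y ge_min lexx.
have yM : y * (M + 1) * 2 <= Im Q.[0].
  have : y <= Im Q.[0] / (M + 1) / 2 by rewrite /y ge_min lexx orbT.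
  by rewrite !ler_pdivlMr //; lra.
have := h y; rewrite y0 y1 => /(_ isT).
rewrite {1}ET hornerD hornerC hornerM hornerX Im_add Im_mul /= mul0r addr0.
have := hM y%:C; rewrite normc_real (ger0_norm (ltW y0)) => /(_ y1) hy.
have := Im_le_normc T.[y%:C]; rewrite ler_norml => /andP[h1 _].
by nra.
Qed.

(** The difference of the squared moduli at [i y] is a polynomial in the real
    parameter [y], so the previous limit argument applies. *)
Lemma le_normc_at0 (A B : {poly C}) :
  (forall y : R, 0 < y <= 1 -> normc A.[y *i] <= normc B.[y *i]) ->
  normc A.[0] <= normc B.[0].
Proof.
move=> h; pose L : {poly C} := 'i *: 'X.
pose S (T : {poly C}) := (T \Po L) * map_poly (@conjc R) (T \Po L).
have SE T (y : R) : (S T).[y%:C] = (normc T.[y *i] ^+ 2)%:C.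
  have iy : 'i * y%:C = y *i :> C.
    by apply/eqP; rewrite eq_complex /=; apply/andP; split; apply/eqP; ring.
  rewrite /S hornerM -[X in _ * _.[X]]conjc_real horner_map /= horner_comp.
  rewrite hornerZ hornerX iy; case: T.[_] => a b; rewrite normc_sqr.
  by apply/eqP; rewrite eq_complex /=; apply/andP; split; apply/eqP; ring.
have E (y : R) : Im ('i *: (S A - S B)).[y%:C] =
     normc A.[y *i] ^+ 2 - normc B.[y *i] ^+ 2.
  by rewrite hornerZ hornerD hornerN !SE Im_mul /=; ring.
have := @Im_horner0_le0 ('i *: (S A - S B)) _.
rewrite ler_normc; have := E 0; rewrite /= => -> /(_ _).
rewrite subr_le0; apply=> y hy; rewrite E subr_le0 -ler_normc; exact: h.
Qed.

Lemma ustable_factor (Q : {poly C}) : Q.[0] != 0 -> ustable Q ->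
  exists2 s, Q = Q.[0] *: \prod_(a <- s) (1 + a *: 'X)
    & forall a, a \in s -> Im a <= 0.
Proof.
move=> Q0 sQ; have [s Es hs] := factor_at0 Q0; exists s => // a /hs[a0 ra].
rewrite leNgt; apply/negP => ai; have /sQ : 0 < Im (- a^-1).
  by rewrite Im_opp Im_inv mulNr opprK divr_gt0 ?exprn_gt0 ?normc_gt0.
by rewrite (rootP ra) eqxx.
Qed.

(** For [Q = Q_0 prod (1 + a X)] this is
    [|sum a|^2 - Re ((sum a)^2 - sum a^2)], the bound of [sum_sqr_le] written with
    the coefficients of [Q]. *)
Definition sq_root_sum (Q : {poly C}) : R :=
  normc (Q`_1 / Q`_0) ^+ 2 - 2 * Re (Q`_2 / Q`_0).

Lemma ustable_root_sums (Q : {poly C}) : Q`_0 != 0 -> ustable Q ->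
  exists s, [/\ Q = Q`_0 *: \prod_(a <- s) (1 + a *: 'X),
    forall a, a \in s -> Im a <= 0,
    \sum_(a <- s) a = Q`_1 / Q`_0 &
    \sum_(a <- s) normc a ^+ 2 <= sq_root_sum Q].
Proof.
rewrite -horner_coef0 => Q0 sQ; have [s Es hs] := ustable_factor Q0 sQ.
have E1 : \sum_(a <- s) a = Q`_1 / Q.[0].
  by rewrite {1}Es coefZ factors_coef1 mulrAC divff ?mul1r.
have E2 : Re (Q`_2 / Q.[0]) * 2 = Re ((\sum_(a <- s) a) ^+ 2 - \sum_(a <- s) a ^+ 2).
  rewrite -factors_coef2 {1}Es coefZ mulrAC divff ?mul1r //.
  by rewrite mulr2n Re_add; lra.
exists s; split=> //.
by have := sum_sqr_le hs; rewrite /sq_root_sum -E2 E1 -horner_coef0; lra.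
Qed.

Lemma sq_root_sum_ge0 (Q : {poly C}) : Q`_0 != 0 -> ustable Q -> 0 <= sq_root_sum Q.
Proof.
move=> Q0 /(ustable_root_sums Q0)[s [_ _ _]]; apply: le_trans.
by apply: sumr_ge0 => a _; rewrite exprn_ge0 ?normc_ge0.
Qed.

(** The Szasz inequality: a stable polynomial is controlled everywhere by its
    first three coefficients. *)
Lemma szasz (Q : {poly C}) z : Q`_0 != 0 -> ustable Q ->
  normc Q.[z] <= normc Q`_0 *
    expR (normc (Q`_1 / Q`_0) * normc z + normc z ^+ 2 * sq_root_sum Q / 2).
Proof.
move=> Q0 /(ustable_root_sums Q0)[s [Es hs E1 E2]].
rewrite {1}Es hornerZ Normc.normcM horner_factors.
rewrite ler_wpM2l ?normc_ge0 //; apply: le_trans (normc_prod1D_le _ _) _.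
rewrite exp.ler_expR E1; apply: lerD.
  rewrite mulrC -Normc.normcM [_ * z]mulrC.
  by apply: le_trans (ler_norm _) _; rewrite mulrC Re_le_normc.
by have := ler_wpM2l (exprn_ge0 2 (normc_ge0 z)) E2; lra.
Qed.

Lemma ustable_ge_coef0 (Q : {poly C}) (y : R) : Q`_0 != 0 -> ustable Q -> 0 <= y ->
  normc Q`_0 <= normc Q.[y *i].
Proof.
move=> Q0 /(ustable_root_sums Q0)[s [Es hs _ _]] y0.
rewrite [X in X.[_]]Es hornerZ Normc.normcM horner_factors.
by rewrite ler_peMr ?normc_ge0 // normc_prod1D_ge1.
Qed.

(** At [i y] the logarithmic derivative is the sum of the [a / (1 + a i y)], whose
    denominators have modulus at least 1, and
    [- Im (a / (1 + a i y)) <= - Im a + |a|^2 y]. *)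
Lemma ustable_logderiv (Q : {poly C}) (y : R) : Q`_0 != 0 -> ustable Q -> 0 < y ->
  - Im (Q^`().[y *i] / Q.[y *i]) <= normc (Q`_1 / Q`_0) + sq_root_sum Q * y.
Proof.
move=> Q0 sQ y0; have [s [Es hs E1 E2]] := ustable_root_sums Q0 sQ.
have n1 a : a \in s -> 1 <= normc (1 + a * (y *i)) ^+ 2.
  move=> /hs ha; rewrite normc_sqr Re_add Im_add Re_mul Im_mul /=.
  have := sqr_ge0 (Re a * y); have := sqr_ge0 (Im a * y).
  by have : 0 <= - Im a * y; [rewrite mulr_ge0 ?oppr_ge0 // ltW|nra].
have n0 a : a \in s -> 1 + a * (y *i) != 0.
  by move=> /n1 ha; apply/eqP => a0; move: ha; rewrite a0 Normc.normc0 expr0n /=; lra.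
have -> : Q^`().[y *i] / Q.[y *i] = \sum_(a <- s) a / (1 + a * (y *i)).
  rewrite [X in X^`()]Es [X in _ / X.[_]]Es derivZ !hornerZ deriv_factors //.
  rewrite horner_factors; set p := \prod_(a <- s) _.
  have p0 : p != 0 by rewrite prodf_seq_neq0; apply/allP => a /n0 ->.
  by field; rewrite ?Q0 ?p0.
rewrite Im_sum -sumrN.
apply: (@le_trans _ _ (\sum_(a <- s) (- Im a + normc a ^+ 2 * y))).
  rewrite big_seq [leRHS]big_seq; apply: ler_sum => a ha.
  rewrite Im_mul Re_inv Im_inv Re_add Im_add Re_mul Im_mul /=.
  rewrite !mulrA -mulrDl -mulNr ler_pdivrMr; last by have := n1 a ha; lra.
  apply: (@le_trans _ _ ((- Im a + normc a ^+ 2 * y) * 1)).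
    by rewrite normc_sqr; lra.
  rewrite ler_wpM2l ?n1 //.
  by rewrite addr_ge0 ?oppr_ge0 ?hs // mulr_ge0 ?exprn_ge0 ?normc_ge0 // ltW.
rewrite big_split /= sumrN -mulr_suml; apply: lerD.
  by rewrite -Im_sum E1; have := Im_le_normc (Q`_1 / Q`_0); rewrite ler_norml; lra.
by rewrite ler_wpM2r // ltW.
Qed.

End Univariate.

(** * Pick functions with a pole at the origin *)

Section Ratio.
Variable R : realType.
Local Notation C := R[i].
Implicit Types (P G : {poly C}) (y : R).

(** The factor [z] accounts for [P] and [G] being stripped of their powers of the
    variable: in the application [G] is one order lower than [P], so the quotient
    has a simple pole at the origin. *)
Definition pick_ratio P G (z : C) := G.[z] / (z * P.[z]).

Definition pick_pair P G :=
  ustable P /\ forall z, 0 < Im z -> Im (pick_ratio P G z) <= 0.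

Lemma Im_neq0 (z : C) : 0 < Im z -> z != 0.
Proof. by move=> z0; apply/eqP => ze; move: z0; rewrite ze ltxx. Qed.

Lemma Im_div (a b : C) : Im (a / b) = Im (a * b^*) / normc b ^+ 2.
Proof.
rewrite Im_mul Re_inv Im_inv Im_mul; case: b => b1 b2 /=.
by rewrite !mulrA -mulrDl.
Qed.

(** Near the origin the quotient behaves like [G`_0 / z], and [Im (c / z) <= 0] on
    the whole upper half-plane forces [c] to be real and nonnegative. *)
Lemma pick_pair_coef0 P G : P`_0 = 1 -> pick_pair P G ->
  exists2 k, 0 <= k & G`_0 = k%:C.
Proof.
move=> P0 [sP hG].
have key (w : C) : 0 < Im w -> Im (G`_0 * w^*) <= 0.
  move=> w0; pose L : {poly C} := w *: 'X.
  pose Q := (G \Po L) * map_poly (@conjc R) (P \Po L) * (w^*)%:P.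
  have QE y : Q.[y%:C] = G.[w * y%:C] * (P.[w * y%:C])^* * w^*.
    rewrite /Q !hornerM hornerC horner_comp -[y%:C in X in _ * X * _]conjc_real.
    by rewrite horner_map /= horner_comp /L !hornerE.
  have := @Im_horner0_le0 R Q _.
  have -> : Q.[0] = G`_0 * w^*.
    rewrite -[X in Q.[X]](rmorph0 (real_complex R)) QE rmorph0 mulr0.
    by rewrite !horner_coef0 P0 rmorph1 mulr1.
  apply=> y /andP[y0 _].
  have wy0 : 0 < Im (w * y%:C) by rewrite Im_mul /= mulr0 add0r mulr_gt0.
  have := hG _ wy0; have := sP _ wy0; rewrite /pick_ratio QE.
  move: G.[_] P.[_] => a b b0.
  rewrite Im_div pmulr_lle0; last first.
    rewrite invr_gt0 exprn_gt0 // normc_gt0 // mulf_neq0 //.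
    by rewrite Im_neq0.
  have -> : Im (a * (w * y%:C * b)^*) = y * Im (a * b^* * w^*).
    by case: a b w {b0 w0 L Q QE wy0} => a1 a2 [b1 b2] [w1 w2] /=; ring.
  by rewrite pmulr_rle0.
(* As the imaginary part of [w] is 1, a large real part of [w] would violate [key]
   unless the imaginary part vanishes. *)
have g0 : Im G`_0 = 0.
  apply/eqP; apply/negPn/negP => g0.
  have := key (((Re G`_0 + 1) / Im G`_0) +i* 1) ltr01.
  by rewrite Im_mul /= [Im _ * _]mulrC divfK //; lra.
exists (Re G`_0); last by rewrite [LHS]complexE g0 rmorph0 mulr0 addr0.
have := key 'i ltr01; rewrite Im_mul /= g0; lra.
Qed.

(** At a root of [P + G] the quotient would be [- 1 / z], whose imaginary part is
    positive. *)
Lemma pick_pair_sum_stable P G : pick_pair P G -> ustable (P + G).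
Proof.
move=> [sP hG] z z0; apply/eqP; rewrite hornerD => E.
have := hG z z0; rewrite /pick_ratio.
have -> : G.[z] / (z * P.[z]) = - z^-1.
  have -> : G.[z] = - P.[z] by apply/eqP; rewrite -addr_eq0 addrC E.
  by have := sP z z0; have := Im_neq0 z0; move: P.[z] => b z0' b0; field; rewrite ?z0' ?b0.
rewrite Im_opp Im_inv mulNr opprK leNgt divr_gt0 //.
by rewrite exprn_gt0 ?normc_gt0 ?Im_neq0.
Qed.

Lemma sq_root_sum_add P G k : P`_0 = 1 -> G`_0 = k%:C -> 0 <= k ->
  sq_root_sum (P + G) = normc (P`_1 + G`_1) ^+ 2 / (1 + k) ^+ 2
                  - 2 * Re (P`_2 + G`_2) / (1 + k).
Proof.
move=> P0 G0 k0; rewrite /sq_root_sum !coefD P0 G0.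
have -> : 1 + k%:C = (1 + k)%:C by rewrite rmorphD.
rewrite -fmorphV Normc.normcM normc_real Re_mul /= mulr0 subr0.
have k1 : 0 < 1 + k by lra.
by rewrite ger0_norm ?invr_ge0 ?ltW //; field; rewrite gt_eqF.
Qed.

(** Stability of [P + G] bounds the real part of its second coefficient from above,
    since [sq_root_sum] is nonnegative. *)
Lemma pick_pair_Re_coef2 P G : P`_0 = 1 -> pick_pair P G ->
  2 * Re (P`_2 + G`_2) <= normc (P`_1 + G`_1) ^+ 2.
Proof.
move=> P0 pp; have [k k0 G0] := pick_pair_coef0 P0 pp.
have W0 : (P + G)`_0 != 0.
  by rewrite coefD P0 G0 -(rmorphD (real_complex R) 1 k) real_complex_eq0 gt_eqF //; lra.
have := sq_root_sum_ge0 W0 (pick_pair_sum_stable pp); rewrite (sq_root_sum_add P0 G0 k0).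
set N := normc _ ^+ 2; set X := Re _.
have N0 : 0 <= N by rewrite exprn_ge0 ?normc_ge0.
have k1 : 0 < 1 + k by lra.
have -> : N / (1 + k) ^+ 2 - 2 * X / (1 + k) = (N - 2 * X * (1 + k)) / (1 + k) ^+ 2.
  by field; rewrite gt_eqF.
rewrite pmulr_lge0; last by rewrite invr_gt0 exprn_gt0.
by nra.
Qed.

(** Near the origin: [i y * pick_ratio P G (i y) + 1] is the quotient of [P + G] by
    [P]; the numerator obeys the Szasz inequality, and on the imaginary axis [P] is
    bounded below by its constant coefficient. *)
Lemma pick_pair_small P G (S kmax y : R) : P`_0 = 1 -> pick_pair P G ->
  Re G`_0 <= kmax ->
  normc (P`_1 + G`_1) ^+ 2 <= S ->
  normc (P`_1 + G`_1) ^+ 2 - 2 * Re (P`_2 + G`_2) <= S -> 0 < y <= 1 ->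
  y * normc (pick_ratio P G (y *i)) <= 1 + (1 + kmax) * expR (normc (P`_1 + G`_1) + S / 2).
Proof.
move=> P0 pp Gk S1 S2 /andP[y0 y1]; have [k k0 G0] := pick_pair_coef0 P0 pp.
rewrite G0 /= in Gk.
have [sP _] := pp; have iy0 : 0 < Im (y *i) by [].
have Pz := sP _ iy0; have z0 := Im_neq0 iy0.
have P1 : 1 <= normc P.[y *i].
  rewrite -(Normc.normc1 R) -[X in normc X](P0 : _ = 1%C).
  by apply: ustable_ge_coef0; rewrite ?P0 ?oner_eq0 // ltW.
have ny : normc (y *i) = y by rewrite /= expr0n add0r sqrtr_sqr ger0_norm // ltW.
have k1C : 1 + k%:C = (1 + k)%:C by rewrite rmorphD.
have W0 : (P + G)`_0 != 0.
  by rewrite coefD P0 G0 k1C real_complex_eq0 gt_eqF //; lra.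
have := szasz (y *i) W0 (pick_pair_sum_stable pp).
rewrite (sq_root_sum_add P0 G0 k0) !coefD P0 G0 k1C normc_real ger0_norm; last by lra.
rewrite -fmorphV Normc.normcM normc_real ger0_norm ?invr_ge0; last by lra.
rewrite ny; set N := normc (P`_1 + G`_1) in S1 S2 *; set X := Re (P`_2 + G`_2) in S2 *.
set q := _ - 2 * X / _ => hW.
have N0 : 0 <= N by rewrite normc_ge0.
have i1 : (1 + k)^-1 <= 1 by rewrite invf_le1; lra.
have i0 : 0 <= (1 + k)^-1 by rewrite invr_ge0; lra.
have qS : q <= S.
  rewrite /q -exprVn; set t := (1 + k)^-1 in i0 i1 *.
  have : N ^+ 2 * t ^+ 2 <= N ^+ 2 * t.
    by apply: ler_wpM2l; rewrite ?exprn_ge0 // expr2 ler_piMr.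
  have : 0 <= N ^+ 2 by rewrite exprn_ge0.
  case: (lerP 0 X) => hX.
    have : 0 <= X * t by rewrite mulr_ge0.
    by nra.
  by nra.
have S0 : 0 <= S by apply: le_trans S1; rewrite exprn_ge0.
have {}hW : normc (P + G).[y *i] <= (1 + kmax) * expR (N + S / 2).
  apply: le_trans hW _; apply: ler_pM; rewrite ?exp.expR_ge0 //; try lra.
  rewrite exp.ler_expR; apply: lerD.
    rewrite -mulrA; apply: ler_piMr => //.
    by rewrite mulr_ile1 // ltW.
  apply: (@le_trans _ _ (y ^+ 2 * S / 2)).
    by have := ler_wpM2l (exprn_ge0 2 (ltW y0)) qS; lra.
  have : y ^+ 2 <= 1 by rewrite expr_le1 // ltW.
  by nra.
have E : y *i * pick_ratio P G (y *i) = ((P + G).[y *i] - P.[y *i]) / P.[y *i].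
  rewrite /pick_ratio hornerD; move: z0 Pz; move: (y *i) P.[_] => z b z0 b0.
  by field; rewrite z0 b0.
rewrite -[y in y * _]ny -Normc.normcM E Normc.normcM Normc.normcV ler_pdivrMr; last by lra.
have := le_normcD (P + G).[y *i] (- P.[y *i]); rewrite normcN => h.
have : 0 <= normc (P + G).[y *i] by rewrite normc_ge0.
by nra.
Qed.

End Ratio.

(** * Growth of the logarithmic derivative on the diagonal *)

Section Bound.
Variable R : realType.
Local Notation C := R[i].

(** If [f = X^r P] then [X f' = X^r euler r P]. *)
Definition euler (r : nat) (P : {poly C}) : {poly C} := r%:R *: P + 'X * P^`().

Lemma coef_euler r P j : (euler r P)`_j = (r + j)%:R * P`_j.
Proof.
rewrite coefD coefZ coefXM coef_deriv natrD mulrDl; congr (_ + _).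
by case: j => [|j] /=; rewrite ?mul0r // mulr_natl.
Qed.

(** Bound on [sq_root_sum P] when [P`_0 = 1] and [m], [k] are the moduli of [P`_1]
    and [P`_2]. *)
Definition sq_bound (m k : R) : R := m ^+ 2 + 2 * k.

(** Bound on [sq_root_sum (P + G)], with [g] a bound on the modulus of
    [G`_1]; its first two terms bound [- 2 Re G`_2]. *)
Definition pair_sq_bound (r : nat) (m k g : R) : R :=
  ((r%:R + 2) * m + g) ^+ 2 + 2 * (r%:R + 3) * k + (m + g) ^+ 2 + 2 * k.

(** Bound on [y |pick_ratio P G (i y)|] for [0 < y <= 1]. *)
Definition low_bound (r : nat) (m k g : R) : R :=
  1 + (1 + r%:R) * expR (m + g + pair_sq_bound r m k g / 2).

(** Slope of the linear bound on [|pick_ratio P G (i y)|] for [y >= 1/2]; the factor 8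
    is the 4 of the Harnack inequality, doubled by the geometric series. *)
Definition slope_bound (r : nat) (m k : R) : R := 8 * (r%:R + m + sq_bound m k).

Variables (r : nat) (P G : {poly C}) (g : R).
Hypotheses (P0 : P`_0 = 1) (pp : pick_pair P G).
Hypotheses (pp' : pick_pair P (euler r P - G)) (hg : normc G`_1 <= g).
Let m := normc P`_1.
Let k := normc P`_2.
Let B := sq_bound m k.
Let S := pair_sq_bound r m k g.
Let K := low_bound r m k g.
Let beta := slope_bound r m k.

Let m0 : 0 <= m. Proof. exact: normc_ge0. Qed.
Let k0 : 0 <= k. Proof. exact: normc_ge0. Qed.
Let g0 : 0 <= g. Proof. exact: le_trans (normc_ge0 _) hg. Qed.
Let B0 : 0 <= B. Proof. by rewrite addr_ge0 ?exprn_ge0 ?mulr_ge0. Qed.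
Let b0 : 0 <= beta.
Proof. by apply: mulr_ge0 => //; apply: addr_ge0 => //; apply: addr_ge0. Qed.
Let K0 : 0 <= K.
Proof. by rewrite addr_ge0 // mulr_ge0 ?exp.expR_ge0 ?addr_ge0. Qed.
Let sP : ustable P. Proof. by case: pp. Qed.
Let P0n : P`_0 != 0. Proof. by rewrite P0 oner_eq0. Qed.

Lemma sq_root_sum_le : sq_root_sum P <= B.
Proof.
rewrite /sq_root_sum P0 !divr1 /B /sq_bound -/m; have := Re_le_normc P`_2.
by rewrite -/k ler_norml => /andP[]; lra.
Qed.

(** The complementary pair [euler r P - G] also has a nonnegative residue, and
    the two residues add up to [r]. *)
Lemma pair_coef0_le : Re G`_0 <= r%:R.
Proof.
have [c c0] := pick_pair_coef0 P0 pp'.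
rewrite coefB coef_euler P0 mulr1 addn0 => /(congr1 (@complex.Re R)).
rewrite Re_add Re_opp -(rmorph_nat (real_complex R)) /= => E.
by move: c0; rewrite -E; lra.
Qed.

(** The missing lower bound on the real part of [G`_2] is the upper bound
    [pick_pair_Re_coef2] for the complementary pair. *)
Lemma pair_small y : 0 < y <= 1 -> y * normc (pick_ratio P G (y *i)) <= K.
Proof.
move=> y01.
have h1 : normc (P`_1 + G`_1) <= m + g.
  by apply: le_trans (le_normcD _ _) _; rewrite lerD2l.
have h1' : normc (P`_1 + G`_1) ^+ 2 <= (m + g) ^+ 2.
  by apply: lerXn2r; rewrite ?nnegrE ?normc_ge0 // addr_ge0.
have h2 : - (2 * Re G`_2) <= ((r%:R + 2) * m + g) ^+ 2 + 2 * (r%:R + 3) * k.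
  have := pick_pair_Re_coef2 P0 pp'; rewrite !coefB !coef_euler.
  have -> : P`_1 + ((r + 1)%:R * P`_1 - G`_1) = (r + 2)%:R%:C * P`_1 - G`_1.
    by rewrite rmorph_nat !natrD; ring.
  have -> : P`_2 + ((r + 2)%:R * P`_2 - G`_2) = (r + 3)%:R%:C * P`_2 - G`_2.
    by rewrite rmorph_nat !natrD; ring.
  rewrite Re_add Re_opp Re_mul /= mul0r subr0 => h.
  have h3 : normc ((r + 2)%:R%:C * P`_1 - G`_1) <= (r%:R + 2) * m + g.
    apply: le_trans (le_normcD _ _) _; rewrite normcN Normc.normcM normc_real.
    by rewrite natrD ger0_norm ?addr_ge0 // lerD2l.
  have h4 : normc ((r + 2)%:R%:C * P`_1 - G`_1) ^+ 2 <= ((r%:R + 2) * m + g) ^+ 2.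
    apply: lerXn2r; rewrite ?nnegrE ?normc_ge0 //.
    by rewrite addr_ge0 ?mulr_ge0 ?addr_ge0.
  have := Re_le_normc P`_2; rewrite ler_norml -/k => /andP[h5 h6].
  rewrite natrD in h; have : (r%:R + 3) * - k <= (r%:R + 3) * Re P`_2.
    by apply: ler_wpM2l; rewrite ?addr_ge0.
  by lra.
have h5 : 0 <= ((r%:R + 2) * m + g) ^+ 2 + 2 * (r%:R + 3) * k.
  by rewrite addr_ge0 ?exprn_ge0 ?mulr_ge0 ?addr_ge0 ?mulr_ge0 ?addr_ge0.
have := Re_le_normc P`_2; rewrite ler_norml -/k => /andP[h7 h8].
have S1 : normc (P`_1 + G`_1) ^+ 2 <= S by rewrite /S /pair_sq_bound; lra.
have S2 : normc (P`_1 + G`_1) ^+ 2 - 2 * Re (P`_2 + G`_2) <= S.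
  by rewrite Re_add /S /pair_sq_bound; lra.
apply: le_trans (pick_pair_small P0 pp pair_coef0_le S1 S2 y01) _.
rewrite /K /low_bound lerD2l ler_wpM2l ?addr_ge0 // exp.ler_expR.
by rewrite -/S lerD2r.
Qed.

(** Both complementary quotients have nonpositive imaginary part and their sum is
    [r / z + P' / P], so each is bounded by the sum, which only depends on [P]. *)
Lemma pair_Im y : 0 < y -> - Im (pick_ratio P G (y *i)) <= r%:R / y + m + B * y.
Proof.
move=> y0; have iy0 : 0 < Im (y *i) by [].
have Pz := sP iy0; have z0 := Im_neq0 iy0.
have := pp'.2 _ iy0; rewrite /pick_ratio hornerD hornerN mulrBl Im_add Im_opp.
have -> : (euler r P).[y *i] / (y *i * P.[y *i]) =
    r%:R%:C / (y *i) + P^`().[y *i] / P.[y *i].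
  rewrite rmorph_nat !hornerE; move: z0 Pz; move: (y *i) P.[_] P^`().[_] => z b c z0 bn0.
  by field; rewrite z0 bn0.
have -> : Im (r%:R%:C / (y *i) + P^`().[y *i] / P.[y *i]) =
    - (r%:R / y) + Im (P^`().[y *i] / P.[y *i]).
  rewrite Im_add; congr (_ + _).
  by rewrite Im_mul Im_inv normc_sqr /= mul0r addr0 expr0n add0r; field; rewrite gt_eqF.
have := ustable_logderiv P0n sP y0; rewrite P0 divr1 -/m.
have := ler_wpM2r (ltW y0) sq_root_sum_le.
by lra.
Qed.

Lemma pair_harnack y s : 0 < y -> normc (s - y *i) <= y / 2 ->
  normc (pick_ratio P G s - pick_ratio P G (y *i)) <= 4 * (r%:R / y + m + B * y).
Proof.
move=> y0 sy.
have E z : pick_ratio P G z = G.[z] / ('X * P).[z] by rewrite hornerM hornerX.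
apply: (@le_trans _ _ (- 4 * Im (pick_ratio P G (y *i)))); last first.
  by have := pair_Im y0; lra.
rewrite !E; apply: harnack => // z z0; last by rewrite -E; apply: pp.2.
by rewrite hornerM hornerX mulf_neq0 ?sP ?Im_neq0.
Qed.

(** Only the imaginary part of the quotient is known far from the origin.  By the
    Harnack inequality, halving [y] changes the quotient by a multiple of the
    imaginary part, which is of size [y]; these changes form a geometric series
    when [y] is divided by 2 until it falls into the interval [1/2, 1], where
    [pair_small] applies. *)
Lemma pair_chain y : 1 / 2 <= y ->
  normc (pick_ratio P G (y *i)) <= 2 * K + beta * y.
Proof.
suff H j : forall y, 1 / 2 <= y <= 2 ^+ j ->
    normc (pick_ratio P G (y *i)) <= 2 * K + beta * y.
  move=> y2; apply: (H (Num.bound y)); rewrite y2 /=.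
  have := archi_boundP (le_trans _ y2 : 0 <= y) => /(_ ltac:(lra)) h.
  apply: ltW; apply: lt_trans h _; elim: (Num.bound y) => [|j IH]; first by rewrite expr0.
  rewrite exprS -natr1; have : 1 <= 2 ^+ j :> R by rewrite exprn_ege1 //; lra.
  by lra.
have small z : 1 / 2 <= z -> z <= 1 -> normc (pick_ratio P G (z *i)) <= 2 * K + beta * z.
  move=> z2 z1; have z0 : 0 < z by lra.
  have := @pair_small z; rewrite z0 z1 => /(_ isT) h.
  have : 0 <= beta * z by rewrite mulr_ge0 // ltW.
  have := normc_ge0 (pick_ratio P G (z *i)).
  by nra.
elim: j => [|j IH] z /andP[z2]; first by rewrite expr0; apply: small.
rewrite exprS => zj; have [z1|z1] := lerP z 1; first exact: small.
have z0 : 0 < z by lra.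
have h1 : normc (pick_ratio P G (z *i)) <= normc (pick_ratio P G ((z / 2) *i)) + 4 * (r%:R / z + m + B * z).
  have hz : normc ((z / 2) *i - z *i : C) <= z / 2.
    have -> : (z / 2) *i - z *i = (- (z / 2)) *i :> C.
      by apply/eqP; rewrite eq_complex /= subrr eqxx /=; apply/eqP; field.
    by rewrite /= expr0n add0r sqrtr_sqr normrN ger0_norm //; lra.
  have H := pair_harnack z0 hz; rewrite -normcN opprB in H.
  have := le_normcD (pick_ratio P G (z *i) - pick_ratio P G ((z / 2) *i))
                    (pick_ratio P G ((z / 2) *i)).
  by rewrite subrK; lra.
have h2 : normc (pick_ratio P G ((z / 2) *i)) <= 2 * K + beta * (z / 2).
  by apply: IH; apply/andP; split; lra.
have h3 : r%:R / z <= r%:R * z.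
  rewrite ler_pdivrMr // -mulrA; apply: ler_peMr => //.
  by nra.
have h4 : m <= m * z by apply: ler_peMr => //; apply: ltW.
have : beta * z = 8 * (r%:R * z + m * z + B * z) by rewrite /beta /slope_bound -/B; ring.
by lra.
Qed.

Lemma pair_axis y : 0 < y ->
  y * normc (pick_ratio P G (y *i)) <= K + 2 * K * y + beta * y ^+ 2.
Proof.
move=> y0.
have Ky : 0 <= K * y by rewrite mulr_ge0 // ltW.
have by2 : 0 <= beta * y ^+ 2 by rewrite mulr_ge0 // exprn_ge0 // ltW.
have [y1|y1] := lerP y 1.
  have := @pair_small y; rewrite y0 y1 => /(_ isT); lra.
have /pair_chain h : 1 / 2 <= y by lra.
by have := ler_wpM2l (ltW y0) h; have := K0; lra.
Qed.

Lemma normc_base (rho : R) : 0 < rho ->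
  rho <= normc (rho%:C * (-1 +i* 2)) <= 3 * rho.
Proof.
move=> h; rewrite Normc.normcM normc_real (gtr0_norm h) mulrC.
have h1 : 1 <= normc (-1 +i* 2 : C) <= 3.
  have n0 := normc_ge0 (-1 +i* 2 : C).
  have h2 : normc (-1 +i* 2 : C) ^+ 2 = 5 by rewrite normc_sqr /=; ring.
  by move: n0 h2; move: (normc _) => t n0 h2; apply/andP; split; nra.
by case/andP: h1 => h1 h2; apply/andP; split; nra.
Qed.

(** The base point [rho (-1 + 2i)] is at distance [rho] from [2 i rho], within reach
    of one more application of the Harnack inequality. *)
Lemma pair_base (rho : R) : 0 < rho ->
  2 * rho * normc (pick_ratio P G (rho%:C * (-1 +i* 2))) <=
  K + 4 * K * rho + 4 * beta * rho ^+ 2 + 4 * (r%:R + 2 * m * rho + 4 * B * rho ^+ 2).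
Proof.
move=> h; have h2 : 0 < 2 * rho by lra.
have := @pair_harnack (2 * rho) (rho%:C * (-1 +i* 2)) h2.
have -> : rho%:C * (-1 +i* 2) - (2 * rho) *i = (- rho)%:C.
  by apply/eqP; rewrite eq_complex /=; apply/andP; split; apply/eqP; ring.
rewrite normc_real normrN (gtr0_norm h) => /(_ ltac:(lra)) H.
have {}H := le_trans (le_normcD _ _) (lerD H (lexx (normc (pick_ratio P G ((2 * rho) *i))))).
rewrite subrK addrC in H.
have := ler_wpM2l (ltW h2) H; have := pair_axis h2.
have -> : 2 * rho * (normc (pick_ratio P G ((2 * rho) *i)) + 4 * (r%:R / (2 * rho) + m + B * (2 * rho)))
   = 2 * rho * normc (pick_ratio P G ((2 * rho) *i)) + 4 * (r%:R + 2 * m * rho + 4 * B * rho ^+ 2).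
  by field; rewrite gt_eqF.
by rewrite exprMn; lra.
Qed.

Lemma stable_base (rho : R) : 0 < rho ->
  normc P.[rho%:C * (-1 +i* 2)] <= expR (3 * m * rho + 9 / 2 * B * rho ^+ 2).
Proof.
move=> h; have /andP[_ n3] := normc_base h.
have n0 := normc_ge0 (rho%:C * (-1 +i* 2)).
apply: le_trans (szasz _ P0n sP) _; rewrite P0 Normc.normc1 mul1r exp.ler_expR divr1 -/m.
set N := normc _ in n3 n0 *; have h1 := ler_wpM2l m0 n3.
have h2 : N ^+ 2 <= 9 * rho ^+ 2 by nra.
have h3 := ler_wpM2r B0 h2.
have := ler_wpM2l (exprn_ge0 2 n0) sq_root_sum_le.
by lra.
Qed.

End Bound.

(** * Restriction of a polynomial to a line *)

Section Line.
Variable F : fieldType.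
Variable n : nat.
Implicit Types (p q : {mpoly F[n]}) (a b v : 'I_n -> F).

Definition line p a b : {poly F} := mmap (@polyC F) (fun j => (a j)%:P + b j *: 'X) p.

Definition dirderiv v p : {mpoly F[n]} := \sum_j v j *: p^`M(j).

Lemma horner_line p a b t : (line p a b).[t] = p.@[fun j => a j + b j * t].
Proof.
rewrite mevalE /line /mmap horner_sum; apply: eq_bigr => m _.
rewrite hornerM hornerC horner_prod; congr (_ * _); apply: eq_bigr => j _.
by rewrite horner_exp !hornerE.
Qed.

Lemma line_linear c p q a b : line (c *: p + q) a b = c *: line p a b + line q a b.
Proof. by rewrite /line mmapD mmapZ mul_polyC. Qed.

Lemma lineZ c p a b : line (c *: p) a b = c *: line p a b.
Proof. by rewrite /line mmapZ mul_polyC. Qed.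

Lemma line_sum (I : Type) (s : seq I) (f : I -> {mpoly F[n]}) a b :
  line (\sum_(i <- s) f i) a b = \sum_(i <- s) line (f i) a b.
Proof. exact: raddf_sum. Qed.

Lemma lineM p q a b : line (p * q) a b = line p a b * line q a b.
Proof. exact: rmorphM. Qed.

Lemma line_dirderiv v p a b : line (dirderiv v p) a b = \sum_j v j *: line p^`M(j) a b.
Proof. by rewrite /dirderiv line_sum; apply: eq_bigr => j _; rewrite lineZ. Qed.

(** The chain rule; both sides are derivations in [p], so it is enough to check
    constants and variables. *)
Lemma deriv_line p a b : (line p a b)^`() = line (dirderiv b p) a b.
Proof.
rewrite line_dirderiv.
pose D p := (line p a b)^`() = \sum_j b j *: line p^`M(j) a b.
have DM p1 p2 : D p1 -> D p2 -> D (p1 * p2).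
  rewrite /D => h1 h2; rewrite lineM derivM h1 h2 mulr_suml mulr_sumr -big_split /=.
  apply: eq_bigr => j _; rewrite mderivM /line mmapD !rmorphM /= -/(line _ a b).
  by rewrite scalerDr scalerAl scalerAr.
have D1 : D 1.
  by rewrite /D /line rmorph1 derivC big1 // => j _; rewrite -mpolyC1 mderivC mmap0 scaler0.
have DX i : D 'X_i.
  rewrite /D /line mmapX mmap1U derivD derivC derivZ derivX add0r alg_polyC.
  rewrite (bigD1 i) //= big1 => [|j ji].
    rewrite addr0 mderivX mnm1E eqxx scale1r -{1}[U_(i)%MM]add0m addmK mpolyX0 rmorph1.
    by rewrite alg_polyC.
  by rewrite mderivX mnm1E eq_sym (negPf ji) scale0r mmap0 scaler0.
elim/mpolyind: p => [|c m p _ _ IH]; rewrite -/(D _).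
  by rewrite /D /line mmap0 deriv0 big1 // => j _; rewrite mderiv0 mmap0 scaler0.
rewrite /D line_linear derivD derivZ IH.
have -> : (line 'X_[m] a b)^`() = \sum_j b j *: line ('X_[m])^`M(j) a b.
  rewrite -/(D _) mpolyXE_id; elim/big_ind: _ => // i _.
  by elim: (m i) => [|k IHk]; rewrite ?expr0 // exprS; apply: DM.
rewrite scaler_sumr -big_split; apply: eq_bigr => j _ /=.
by rewrite mderivD mderivZ line_linear scalerDr !scalerA mulrC.
Qed.

Lemma coef0_line p a b : (line p a b)`_0 = p.@[a].
Proof.
rewrite -horner_coef0 horner_line.
by apply: meval_eq => j; rewrite mulr0 addr0.
Qed.

Lemma coef1_line p a b : (line p a b)`_1 = (dirderiv b p).@[a].
Proof. by rewrite -(mulr1n (line p a b)`_1) -coef_deriv deriv_line coef0_line. Qed.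

Lemma line_homog d q x : q \is d.-homog -> line q (fun=> 0) x = q.@[x] *: 'X^d.
Proof.
move=> /dhomogP hq; rewrite mevalE scaler_suml /line /mmap.
rewrite big_seq [RHS]big_seq; apply: eq_bigr => m /hq dm.
rewrite -scalerA mul_polyC; congr (_ *: _).
rewrite /mmap1 /=; under eq_bigr => j _ do rewrite polyC0 add0r exprZn.
by rewrite scaler_prod; congr (_ *: _); rewrite -dm /= prodrXr -mdegE.
Qed.

End Line.

(** * Homogeneous expansion along a ray *)

Section Expansion.
Variable R : realType.
Variable n : nat.
Local Notation C := R[i].
Implicit Types (p q : {mpoly C[n]}) (v x : 'I_n -> C).

Lemma hcomp_partition p k : (msize p <= k)%N -> p = \sum_(d < k) hcomp p d.
Proof. exact: pihomog_partitionE. Qed.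

Lemma coef_line0 p x j : (line p (fun=> 0) x)`_j = (hcomp p j).@[x].
Proof.
rewrite {1}(@hcomp_partition p (maxn (msize p) j.+1)) ?leq_maxl //.
rewrite line_sum coef_sum.
have jk : (j < maxn (msize p) j.+1)%N by rewrite leq_max ltnSn orbT.
rewrite (bigD1 (Ordinal jk)) //= big1 => [|d dj].
  by rewrite addr0 (line_homog x (pihomogP _ _ _)) coefZ coefXn eqxx mulr1.
rewrite (line_homog x (pihomogP _ _ _)) coefZ coefXn.
by rewrite -val_eqE eq_sym in dj; rewrite (negPf dj) mulr0.
Qed.

Lemma line_mderiv_homog d q i x : q \is d.-homog ->
  'X * line q^`M(i) (fun=> 0) x = (q^`M(i)).@[x] *: 'X^d.
Proof.
move=> hq; have supp m : m \in msupp q^`M(i) -> (mdeg m).+1 = d.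
  rewrite mcoeff_msupp mcoeff_mderiv => h.
  rewrite -((dhomogP _ _ _ hq) (m + U_(i))%MM).
    by rewrite /= mdegD mdeg1 addn1.
  by rewrite mcoeff_msupp; apply: contraNneq h => ->; rewrite mul0rn.
case: d hq supp => [|d] hq supp.
  have -> : q^`M(i) = 0.
    apply/eqP; rewrite -msupp_eq0; case E: (msupp _) => [|m s] //.
    by have := supp m; rewrite E mem_head => /(_ isT).
  by rewrite /line mmap0 mulr0 meval0 scale0r.
have /line_homog -> : q^`M(i) \is d.-homog.
  by apply/dhomogP => m /supp [].
by rewrite exprS scalerAr.
Qed.

Lemma coef_line_dirderiv p v x j :
  ('X * line (dirderiv v p) (fun=> 0) x)`_j = (dirderiv v (hcomp p j)).@[x].
Proof.
rewrite line_dirderiv mulr_sumr coef_sum /dirderiv raddf_sum; apply: eq_bigr => i _ /=.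
rewrite -scalerAr coefZ mevalZ; congr (_ * _).
rewrite {1}(@hcomp_partition p (maxn (msize p) j.+1)) ?leq_maxl //.
rewrite raddf_sum line_sum mulr_sumr coef_sum.
have jk : (j < maxn (msize p) j.+1)%N by rewrite leq_max ltnSn orbT.
rewrite (bigD1 (Ordinal jk)) //= big1 => [|d dj].
  by rewrite addr0 (line_mderiv_homog i x (pihomogP _ _ _)) coefZ coefXn eqxx mulr1.
rewrite (line_mderiv_homog i x (pihomogP _ _ _)) coefZ coefXn.
by rewrite -val_eqE eq_sym in dj; rewrite (negPf dj) mulr0.
Qed.

(** A nonzero polynomial has fewer roots than there are points [e/2, e/3, ...]. *)
Lemma poly_neq0_small (Q : {poly C}) (e : R) : Q != 0 -> 0 < e ->
  exists t : R, [/\ 0 < t, t < e & Q.[t%:C] != 0].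
Proof.
move=> Q0 e0; pose f k : R := e / k.+2%:R.
have f0 k : 0 < f k by rewrite divr_gt0.
have f1 k : f k < e by rewrite ltr_pdivrMr // ltr_pMr // ltr1n.
case: (boolP (all (root Q) [seq (f k)%:C | k <- iota 0 (size Q)])) => [h|].
  have := max_poly_roots Q0 h; rewrite size_map size_iota ltnn => /(_ _)/negP[] //.
  rewrite map_inj_uniq ?iota_uniq // => k l /complexI /(mulfI (lt0r_neq0 e0)) /invr_inj.
  by move=> /eqP; rewrite eqr_nat => /eqP[].
by case/allPn=> _ /mapP[k _ ->] hk; exists (f k).
Qed.

(** Induction on the degree of a monomial of [q].  If it is not constant, some
    partial derivative is nonzero at a point of the cube, so [q] is not identically
    zero on the line through this point in that direction and is nonzero at a
    nearby point. *)
Lemma mpoly_neq0_cube q : q != 0 ->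
  exists v : 'I_n -> R, (forall j, 0 <= v j < 1) /\ q.@[fun j => (v j)%:C] != 0.
Proof.
rewrite -msupp_eq0; case E: (msupp q) => [|m s] // _.
have : m \in msupp q by rewrite E mem_head.
move: {2}(mdeg m) (leqnn (mdeg m)) => d; elim: d m {s E} q => [|d IH] m q.
  rewrite leqn0 mdeg_eq0 => /eqP -> m0; exists (fun=> 0); split=> [j|].
    by rewrite lexx ltr01.
  suff -> : q.@[fun=> 0%:C] = q@_0 by rewrite -mcoeff_msupp.
  rewrite mevalE (bigD1_seq 0%MM) ?msupp_uniq //= [X in _ + X]big1 => [|m' m'0].
    by rewrite addr0 big1 ?mulr1 // => i _; rewrite mnm0E.
  have [i mi] : exists i, m' i != 0%N.
    apply/existsP; apply: contraNT m'0; rewrite negb_exists => /forallP h.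
    by apply/eqP/mnmP => i; rewrite mnm0E; apply/eqP; have := h i; rewrite negbK.
  by rewrite (bigD1 i) //= expr0n (negPf mi) mul0r mulr0.
move=> md mq; have [m0|] := eqVneq (mdeg m) 0%N; first by apply: (IH m); rewrite ?m0.
rewrite mdeg_eq0 => m0; have [i mi] : exists i, m i != 0%N.
  apply/existsP; apply: contraNT m0; rewrite negb_exists => /forallP h.
  by apply/eqP/mnmP => i; rewrite mnm0E; apply/eqP; have := h i; rewrite negbK.
have Um : (U_(i) <= m)%MM by rewrite lep1mP.
have [||v [v01 qv]] := IH (m - U_(i))%MM q^`M(i).
- by have := congr1 mdeg (submK Um); rewrite mdegD mdeg1; lia.
- rewrite mcoeff_msupp mcoeff_mderiv submK // -scaler_nat.
  by rewrite scaler_eq0 pnatr_eq0 /= -mcoeff_msupp.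
pose Q := line q (fun j => (v j)%:C) (fun j => (i == j)%:R).
have Q0 : Q != 0.
  apply: contraNneq qv => Q0; have : Q^`().[0] = 0 by rewrite Q0 deriv0 horner0.
  rewrite deriv_line horner_line /dirderiv (bigD1 i) //= eqxx scale1r big1 ?addr0.
    by move=> <-; apply/eqP/meval_eq => j; rewrite mulr0 addr0.
  by move=> j ji; rewrite eq_sym (negPf ji) scale0r.
have [|t [t0 t1 Qt]] := @poly_neq0_small Q (1 - v i) Q0.
  by have := v01 i; lra.
exists (fun j => v j + (i == j)%:R * t); split=> [j|].
  have := v01 j; case: eqP => [<-|_]; rewrite ?mul1r ?mul0r ?addr0 //.
  by move=> /andP[h1 h2]; apply/andP; split; lra.
move: Qt; rewrite horner_line; congr (_ != 0); apply: meval_eq => j.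
by rewrite rmorphD rmorphM rmorph_nat.
Qed.

End Expansion.

(** * Comparison of the values of a stable polynomial at two points *)

Section Stable.
Variable R : realType.
Variable n : nat.
Local Notation C := R[i].
Variable p : {mpoly C[n]}.
Hypothesis sp : stable p.
Implicit Types (z w : 'I_n -> C) (u v : 'I_n -> R).

Local Notation rv v := (fun j => (v j)%:C).

Lemma line_root z v (t : C) : root (line p z (rv v)) t ->
  ~ forall j, 0 < Im (z j) + v j * Im t.
Proof.
move=> /rootP; rewrite horner_line => pt h.
suff /sp : forall j, 0 < Im (z j + (v j)%:C * t) by rewrite pt eqxx.
by move=> j; rewrite Im_add Im_mul /= mul0r addr0.
Qed.

(** Moving each coordinate up by [v j] does not decrease the modulus as soon as
    all points beyond the half-way point lie in the domain of stability; the
    starting point itself may be outside. *)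
Lemma stable_reflection z v :
  (forall j (t : R), 2^-1 < t -> 0 < Im (z j) + v j * t) ->
  normc p.@[z] <= normc p.@[fun j => z j + (v j) *i].
Proof.
move=> h; have := @reflection R (line p z (rv v)) _.
rewrite !horner_line.
have -> : p.@[fun j => z j + (v j)%:C * 0] = p.@[z].
  by apply: meval_eq => j; rewrite mulr0 addr0.
have -> : p.@[fun j => z j + (v j)%:C * 'i] = p.@[fun j => z j + (v j) *i].
  by apply: meval_eq => j; congr (_ + _); apply/eqP; rewrite eq_complex /=; apply/andP; split; apply/eqP; ring.
apply=> t /line_root rt; rewrite leNgt; apply/negP => t2; apply: rt => j.
exact: h.
Qed.

(** On the line through [w] in the direction [v] the logarithmic derivative at [w]
    is the sum of the [a] in the factorisation of a univariate stable polynomial. *)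
Lemma stable_dirderiv_Im w v : (forall j, 0 < Im (w j)) -> (forall j, 0 <= v j) ->
  Im ((dirderiv (rv v) p).@[w] / p.@[w]) <= 0.
Proof.
move=> hw hv; pose Q := line p w (rv v).
have sQ : ustable Q.
  move=> t t0; apply/negP => /line_root; apply=> j.
  by rewrite ltr_pwDl // mulr_ge0 // ltW.
have Q0 : Q`_0 != 0 by rewrite coef0_line; apply: sp.
have [s [_ hs E _]] := ustable_root_sums Q0 sQ.
rewrite -coef1_line -(coef0_line p w (rv v)) -E Im_sum big_seq.
by apply: sumr_le0 => a /hs.
Qed.

(** All roots of [t |-> p (w + t u)] have imaginary part at most -1, because
    [u <= y]; hence [|a|^2 <= - Im a], and the quadratic term of the exponential
    bound is itself dominated by the logarithmic derivative. *)
Lemma stable_shift w u (y : R) : 0 < y -> (forall j, y <= Im (w j)) ->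
  (forall j, 0 <= u j <= y) ->
  normc p.@[fun j => w j + (u j)%:C] <=
  normc p.@[w] * expR (3 / 2 * normc ((dirderiv (rv u) p).@[w] / p.@[w])).
Proof.
move=> y0 hw hu; pose Q := line p w (rv u).
have pw0 : p.@[w] != 0 by apply: sp => j; apply: lt_le_trans (hw j).
have Q0 : Q.[0] = p.@[w] by rewrite horner_coef0 coef0_line.
have Q1 : Q`_1 = (dirderiv (rv u) p).@[w] := coef1_line p w (rv u).
have Qw : Q.[1] = p.@[fun j => w j + (u j)%:C].
  by rewrite horner_line; apply: meval_eq => j; rewrite mulr1.
have Qn0 : Q.[0] != 0 by rewrite Q0.
have [s Es hs] := factor_at0 Qn0.
have E1 : \sum_(a <- s) a = (dirderiv (rv u) p).@[w] / p.@[w].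
  by rewrite -Q1 -Q0 {1}Es coefZ factors_coef1 mulrAC divff ?mul1r.
have ha a : a \in s -> normc a ^+ 2 <= - Im a.
  case/hs=> a0 /line_root ra.
  have i1 : Im (- a^-1) <= -1.
    rewrite leNgt; apply/negP => h; apply: ra => j.
    have /andP[] := hu j; rewrite le_eqVlt => /predU1P[<-|u0] uy.
      by rewrite mul0r addr0; apply: lt_le_trans (hw j).
    by have := hw j; nra.
  have n2 : 0 < normc a ^+ 2 by rewrite exprn_gt0 ?normc_gt0.
  move: i1; rewrite Im_opp Im_inv mulNr opprK ler_pdivrMr //; lra.
rewrite -Qw -Q0 {1}Es hornerZ Normc.normcM horner_factors ler_wpM2l ?normc_ge0 //.
apply: le_trans (normc_prod1D_le _ _) _; rewrite exp.ler_expR mul1r Normc.normc1 expr1n mul1r E1.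
have : \sum_(a <- s) normc a ^+ 2 <= normc ((dirderiv (rv u) p).@[w] / p.@[w]).
  apply: (@le_trans _ _ (\sum_(a <- s) - Im a)).
    by rewrite big_seq [leRHS]big_seq; apply: ler_sum => a /ha.
  rewrite sumrN -Im_sum E1; apply: le_trans (Im_le_normc _).
  by rewrite -normrN ler_norm.
have := le_trans (ler_norm _) (Re_le_normc ((dirderiv (rv u) p).@[w] / p.@[w])).
by rewrite Q0; lra.
Qed.

End Stable.

(** * The global bound *)

Section Main.
Variable R : realType.
Variable n : nat.
Local Notation C := R[i].
Variables (p : {mpoly C[n]}) (r : nat).
Hypotheses (sp : stable p) (vp : vanishes_to_order p r).

Local Notation rv v := (fun j => (v j)%:C).
Local Notation ray x := (line p (fun=> 0) x).
Local Notation lead x := ((hcomp p r).@[x]).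

Lemma line_drop x : ray x = drop_poly r (ray x) * 'X^r.
Proof.
apply/polyP => j; rewrite coefMXn coef_drop_poly; case: ltnP => jr.
  by rewrite coef_line0 vp.2 // meval0.
by rewrite subnK.
Qed.

Lemma drop_dirderiv v x :
  'X * line (dirderiv v p) (fun=> 0) x = drop_poly r ('X * line (dirderiv v p) (fun=> 0) x) * 'X^r.
Proof.
apply/polyP => j; rewrite [RHS]coefMXn coef_drop_poly; case: ltnP => jr.
  rewrite coef_line_dirderiv vp.2 // /dirderiv big1 ?meval0 // => i _.
  by rewrite mderiv0 scaler0.
by rewrite subnK.
Qed.

Lemma horner_ray x t : (ray x).[t] = p.@[fun j => x j * t].
Proof. by rewrite horner_line; apply: meval_eq => j; rewrite add0r. Qed.

(** For [0 <= v <= 1] reflection gives [|p (i y v)| <= |p (i y 1)|]; dividing by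
    [y^r] and letting [y -> 0] yields [|P_r (v)| <= |P_r (1)|], and [P_r] is nonzero
    at some [v] in the cube. *)
Lemma lead_ones_neq0 : lead ones != 0.
Proof.
have [v [v01 pv]] := mpoly_neq0_cube vp.1.
apply: contraNneq pv => p1.
have := @le_normc_at0 R (drop_poly r (ray (rv v))) (drop_poly r (ray ones)) _.
rewrite !horner_coef0 !coef_drop_poly !coef_line0 p1 Normc.normc0 => H.
apply/eqP/Normc.eq0_normc/eqP; rewrite eq_le normc_ge0 andbT; apply: H.
move=> y /andP[y0 _].
have yi0 : 0 < normc (y *i) ^+ r.
  by rewrite exprn_gt0 // normc_gt0 // Im_neq0.
rewrite -(ler_pM2r yi0) -normcX -!Normc.normcM.
have E x : (drop_poly r (ray x)).[y *i] * (y *i) ^+ r = p.@[fun j => x j * (y *i)].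
  by rewrite -horner_ray [in RHS]line_drop hornerM hornerXn.
rewrite !E.
have := @stable_reflection R n p sp (fun j => (v j)%:C * (y *i)) (fun j => y * (1 - v j)) _.
have -> : p.@[fun j => (v j)%:C * (y *i) + (y * (1 - v j)) *i] = p.@[fun j => ones j * (y *i)].
  apply: meval_eq => j; rewrite /ones mul1r.
  by apply/eqP; rewrite eq_complex /=; apply/andP; split; apply/eqP; ring.
apply=> j t t2; rewrite Im_mul /= mul0r addr0.
by have /andP[] := v01 j; have : 0 < y * (t - 2^-1) by [apply: mulr_gt0; lra|]; nra.
Qed.

Local Notation a := (lead ones).

(** The polynomial [t |-> p (t 1)] divided by its lowest term [P_r (1) t^r]. *)
Definition normal_ray := a^-1 *: drop_poly r (ray ones).

(** The polynomial [t |-> t D_v p (t 1)] divided by the same term, so that [D_v p / p]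
    on the diagonal is the [pick_ratio] of the two. *)
Definition normal_slope v := a^-1 *: drop_poly r ('X * line (dirderiv (rv v) p) (fun=> 0) ones).

Lemma normal_ray_coef j : normal_ray`_j = (hcomp p (j + r)).@[ones] / a.
Proof. by rewrite coefZ coef_drop_poly coef_line0 mulrC. Qed.

Lemma normal_ray_coef0 : normal_ray`_0 = 1.
Proof. by rewrite normal_ray_coef divff // lead_ones_neq0. Qed.

Lemma normal_slope_coef v j : (normal_slope v)`_j = (dirderiv (rv v) (hcomp p (j + r))).@[ones] / a.
Proof. by rewrite coefZ coef_drop_poly coef_line_dirderiv mulrC. Qed.

Lemma horner_normal_ray t : p.@[fun=> t] = a * t ^+ r * normal_ray.[t].
Proof.
rewrite hornerZ mulrACA mulrA mulfV ?lead_ones_neq0 // mul1r mulrC.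
have := congr1 (fun Q => Q.[t]) (line_drop ones); rewrite hornerM hornerXn => <-.
by rewrite horner_ray; apply: meval_eq => j; rewrite mul1r.
Qed.

Lemma horner_normal_slope v t : t * (dirderiv (rv v) p).@[fun=> t] = a * t ^+ r * (normal_slope v).[t].
Proof.
rewrite hornerZ mulrACA mulrA mulfV ?lead_ones_neq0 // mul1r [RHS]mulrC.
have := congr1 (fun Q => Q.[t]) (drop_dirderiv (rv v) ones); rewrite hornerM hornerX [RHS]hornerM hornerXn => <-.
by rewrite horner_line; congr (_ * _); apply: meval_eq => j; rewrite add0r mul1r.
Qed.

Lemma pick_ratio_normal v t : t != 0 ->
  pick_ratio normal_ray (normal_slope v) t = (dirderiv (rv v) p).@[fun=> t] / p.@[fun=> t].
Proof.
move=> t0; have c0 : a * t ^+ r != 0 by rewrite mulf_neq0 ?expf_neq0 ?lead_ones_neq0.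
rewrite /pick_ratio -[LHS](mulKf c0).
have -> : (normal_slope v).[t] = (a * t ^+ r)^-1 * (t * (dirderiv (rv v) p).@[fun=> t]).
  by rewrite horner_normal_slope mulKf.
have -> : normal_ray.[t] = (a * t ^+ r)^-1 * p.@[fun=> t] by rewrite horner_normal_ray mulKf.
move: (a * t ^+ r) c0 => c c0; have [->|p0] := eqVneq p.@[fun=> t] 0.
  by rewrite !mulr0 invr0 !mulr0.
by field; rewrite c0 t0 p0.
Qed.

Lemma pick_pair_normal v : (forall j, 0 <= v j) -> pick_pair normal_ray (normal_slope v).
Proof.
move=> v0; split=> z z0.
  have := @sp (fun=> z) (fun=> z0); rewrite horner_normal_ray.
  by apply: contraNneq => ->; rewrite mulr0.
rewrite pick_ratio_normal ?Im_neq0 //; exact: stable_dirderiv_Im.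
Qed.

Lemma euler_hcomp k :
  (dirderiv ones (hcomp p k)).@[ones] = k%:R * (hcomp p k).@[ones].
Proof.
rewrite -(coef_line_dirderiv p ones ones k) -(deriv_line p (fun=> 0) ones).
rewrite coefXM coef_deriv -(coef_line0 p ones k).
by case: k => [|k] /=; rewrite ?mul0r // mulr_natl.
Qed.

(** Complementary directions [v] and [1 - v] give complementary pairs, by Euler's
    identity for homogeneous polynomials. *)
Lemma euler_normal_ray v : euler r normal_ray - normal_slope v = normal_slope (fun j => 1 - v j).
Proof.
apply/polyP => j; rewrite coefB (coef_euler r normal_ray j).
rewrite [RHS]normal_slope_coef (congr2 (fun c d => (r + j)%:R * c - d) (normal_ray_coef j) (normal_slope_coef v j)).
rewrite mulrA -mulrBl; congr (_ / _); rewrite [(r + j)%N]addnC -euler_hcomp.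
rewrite -mevalB /dirderiv -sumrB; congr (_.@[_]); apply: eq_bigr => i _.
by rewrite -scalerBl rmorphB rmorph1.
Qed.

(** Combine a reflection of [z] to the point [Re z + 2 i rho], a shift of this
    point to the diagonal, and the univariate bounds on the diagonal. *)
Lemma stable_bound z (rho g : R) : 0 < rho -> (forall j, normc (z j) <= rho) ->
  \sum_j normc ((grad (hcomp p r.+1) ones j) / a) <= g ->
  let m := normc ((hcomp p r.+1).@[ones] / a) in
  let k := normc ((hcomp p r.+2).@[ones] / a) in
  let K := low_bound r m k g in let B := sq_bound m k in
  let b := slope_bound r m k in
  normc p.@[z] <= rho ^+ r * normc a *
    expR ((8 * r%:R + 3 / 2 * K) + (15 * m + 6 * K) * rho
           + (57 / 2 * B + 6 * b) * rho ^+ 2).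
Proof.
move=> h zr hg; cbv zeta.
set m := normc ((hcomp p r.+1).@[ones] / a); set k := normc ((hcomp p r.+2).@[ones] / a).
set K := low_bound r m k g; set B := sq_bound m k; set b := slope_bound r m k.
have Rez j : `|Re (z j)| <= rho := le_trans (Re_le_normc _) (zr j).
have Imz j : `|Im (z j)| <= rho := le_trans (Im_le_normc _) (zr j).
pose s : C := rho%:C * (-1 +i* 2).
have sI : Im s = 2 * rho by rewrite /s Im_mul /=; ring.
have s0 : s != 0 by apply: Im_neq0; rewrite sI; lra.
(* With this [v] in the cube, [s + 2 rho v j] is [Re (z j) + 2 i rho]. *)
pose v j := (Re (z j) + rho) / (2 * rho).
have v01 j : 0 <= v j <= 1.
  have := Rez j; rewrite ler_norml /v => /andP[h1 h2].
  rewrite divr_ge0 ?ler_pdivrMr /=; lra.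
have step1 : normc p.@[z] <= normc p.@[fun j => s + (2 * rho * v j)%:C].
  have := @stable_reflection R n p sp z (fun j => 2 * rho - Im (z j)) _.
  have -> : p.@[fun j => z j + (2 * rho - Im (z j)) *i] =
            p.@[fun j => s + (2 * rho * v j)%:C].
    apply: meval_eq => j; apply/eqP; rewrite eq_complex Re_add Im_add [Re (_ + _)]Re_add Im_add sI /s Re_mul /=.
    apply/andP; split; apply/eqP; last by ring.
    by rewrite /v; field; rewrite gt_eqF.
  apply=> j t t2; have := Imz j; rewrite ler_norml => /andP[h1 h2].
  by nra.
apply: le_trans step1 _.
apply: le_trans (@stable_shift R n p sp (fun=> s) (fun j => 2 * rho * v j) (2 * rho) _ _ _) _.
- by lra.
- by move=> j; rewrite sI.
- by move=> j; have /andP[h1 h2] := v01 j; apply/andP; split; nra.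
have -> : (dirderiv (rv (fun j => 2 * rho * v j)) p).@[fun=> s] =
    (2 * rho)%:C * (dirderiv (rv v) p).@[fun=> s].
  rewrite -mevalZ; congr (_.@[_]); rewrite /dirderiv scaler_sumr; apply: eq_bigr => j _.
  by rewrite scalerA rmorphM.
rewrite -[(2 * rho)%:C * _ / _]mulrA -pick_ratio_normal // Normc.normcM normc_real ger0_norm; last by lra.
have pp := pick_pair_normal (fun j => proj1 (andP (v01 j))).
have pp' : pick_pair normal_ray (euler r normal_ray - normal_slope v).
  rewrite euler_normal_ray; apply: pick_pair_normal => j; have /andP[] := v01 j; lra.
have hG : normc (normal_slope v)`_1 <= g.
  apply: le_trans hg; rewrite normal_slope_coef /dirderiv raddf_sum mulr_suml.
  apply: le_trans (le_normc_sum _ _) _; apply: ler_sum => j _ /=.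
  rewrite mevalZ -mulrA Normc.normcM normc_real add1n.
  have /andP[h1 h2] := v01 j; rewrite ger0_norm //; apply: ler_piMl => //.
  exact: normc_ge0.
have hb := pair_base normal_ray_coef0 pp pp' hG h.
have hs := stable_base normal_ray_coef0 pp h.
have m1 : normc normal_ray`_1 = m by rewrite normal_ray_coef add1n.
have k2 : normc normal_ray`_2 = k by rewrite normal_ray_coef add2n.
rewrite m1 k2 -/K -/B -/b -/s in hb hs.
rewrite horner_normal_ray [normc (a * _ * _)]Normc.normcM [normc (a * _)]Normc.normcM normcX.
have /andP[_ n3] := normc_base h; rewrite -/s in n3.
(* The factor [3 ^ r] is absorbed into the exponential through [3 <= exp 2]. *)
have h3 : normc s ^+ r <= rho ^+ r * expR (2 * r%:R).
  apply: (@le_trans _ _ ((3 * rho) ^+ r)).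
    by apply: lerXn2r; rewrite ?nnegrE ?normc_ge0 //; lra.
  rewrite exprMn mulrC ler_wpM2l ?exprn_ge0 ?(ltW h) // exp.expRM_natr.
  apply: lerXn2r; rewrite ?nnegrE ?exp.expR_ge0 //.
  by have := exp.expR_ge1Dx (2 : R); lra.
have na : 0 <= normc a := normc_ge0 a.
apply: (@le_trans _ _ (normc a * (rho ^+ r * expR (2 * r%:R)) *
   expR (3 * m * rho + 9 / 2 * B * rho ^+ 2) *
   expR (3 / 2 * (K + 4 * K * rho + 4 * b * rho ^+ 2 + 4 * (r%:R + 2 * m * rho + 4 * B * rho ^+ 2))))).
  apply: ler_pM; rewrite ?mulr_ge0 ?exp.expR_ge0 ?normc_ge0 ?exprn_ge0 ?normc_ge0 //.
    apply: ler_pM; rewrite ?mulr_ge0 ?normc_ge0 ?exprn_ge0 ?normc_ge0 //.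
    by apply: ler_wpM2l.
  rewrite exp.ler_expR; apply: ler_wpM2l; [lra|exact: hb].
set e2 := 3 * m * rho + _; set e3 := 3 / 2 * _.
rewrite [X in _ <= _ * expR X](_ : _ = 2 * r%:R + e2 + e3).
  by rewrite (exp.expRD (_ + e2) e3) (exp.expRD _ e2); clearbody e2 e3; lra.
by rewrite /e2 /e3; clearbody K B b m; field.
Qed.

End Main.

Theorem theorem1p8 (R : realType) (n : nat) :
  exists C0 C1 C2 : data_fun R n,
  forall (r : nat) (p : {mpoly R[i][n]}),
    stable p -> vanishes_to_order p r ->
    let P := hcomp p in
    let const (C : data_fun R n) : R := C r (P r).@[ones] (P r.+1).@[ones] (P r.+2).@[ones]
                     (grad (P r) ones) (grad (P r.+1) ones) in
    forall z : 'I_n -> R[i],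
      Normc.normc p.@[z] <=
        supnorm z ^+ r * Normc.normc (P r).@[ones] *
        sequences.expR (const C0 + const C1 * supnorm z + const C2 * supnorm z ^+ 2).
Proof.
pose m (a b : R[i]) := normc (b / a).
pose g (a : R[i]) (e : 'I_n -> R[i]) := \sum_j normc (e j / a).
exists (fun r a b c _ e => 8 * r%:R + 3 / 2 * low_bound r (m a b) (m a c) (g a e)).
exists (fun r a b c _ e => 15 * m a b + 6 * low_bound r (m a b) (m a c) (g a e)).
exists (fun r a b c _ _ => 57 / 2 * sq_bound (m a b) (m a c) + 6 * slope_bound r (m a b) (m a c)).
move=> r p sp vp P const z.
have zle j : normc (z j) <= supnorm z.
  by rewrite /supnorm; apply: (le_bigmax _ (fun j => normc (z j))).
have s0 : 0 <= supnorm z by rewrite /supnorm bigmax_ge_id.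
(* If the sup norm vanishes, both sides reduce to the value at the origin. *)
move: s0; rewrite le_eqVlt => /predU1P[s0|s0]; last first.
  exact: (stable_bound sp vp s0 zle (lexx _)).
have -> : p.@[z] = p.@[fun=> 0].
  apply: meval_eq => j; apply/Normc.eq0_normc/eqP.
  by rewrite eq_le normc_ge0 andbT s0 zle.
rewrite (horner_normal_ray sp vp) -s0 !Normc.normcM normcX Normc.normc0.
rewrite -mulrA mulrCA -mulrA ler_wpM2l ?exprn_ge0 //.
rewrite horner_coef0 (normal_ray_coef0 sp vp) Normc.normc1 ler_wpM2l ?normc_ge0 //.
rewrite mulr0 expr0n mulr0 !addr0; apply: le_trans (exp.expR_ge1Dx _).
rewrite lerDl /const; apply: addr_ge0; first by rewrite mulr_ge0.
apply: mulr_ge0; first by lra.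
apply: addr_ge0 => //; apply: mulr_ge0; first exact: addr_ge0.
exact: exp.expR_ge0.
Qed.
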